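(* Let $G$ be a locally compact commutative group with dual group $\hat G$ (the group of continuous characters of $G$), let $D$ be a Banach space, $A\subset L(D)$ a Banach algebra of operators, and $g\mapsto T_g$ a representation of $G$ (as a discrete group, i.e. with no continuity assumed) by (invertible) isometries of $D$ such that $T_gAT_g^{-1}=A$ for all $g\in G$. If for every finite set $F\subset G$, all $a_g\in A$ ($g\in F$) and every character $\chi\in\hat G$ the equality $$\Big\|\sum_{g\in F}a_gT_g\Big\|=\Big\|\sum_{g\in F}a_g\,\chi(g)\,T_g\Big\|$$ holds, then the algebra $B(A,T_g)$ possesses the properties ( * ) and ( ** ).
   Context: All Banach spaces are complex; $L(D)$ is the algebra of bounded linear operators on $D$; $A$ is a norm-closed subalgebra of $L(D)$. $B(A,T_g)\subset L(D)$ is the Banach algebra generated by $A$ and $\{T_g\}_{g\in G}$, understood as the norm closure in $L(D)$ of the set of finite sums $\sum_{g\in F}a_gT_g$ ($F\subset G$ finite, $a_g\in A$). Property ( * ): for every finite sum $b=\sum a_gT_g$ with $a_g\in A$ one has $\|b\|\ge\|a_e\|$, where $e$ is the identity of $G$. When ( * ) holds, for every $g_0\in G$ the map $N_{g_0}:\sum a_gT_g\mapsto a_{g_0}$ is well defined on finite sums and extends by continuity to a map $N_{g_0}:B(A,T_g)\to A$. Property ( ** ): $B(A,T_g)$ possesses ( * ) and, for $b\in B(A,T_g)$, $b=0$ if and only if $N_g(b)=0$ for every $g\in G$. *)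

(* Defs.v *)
From HB Require Import structures.
From mathcomp Require Import all_boot all_order all_algebra.
From mathcomp Require Import finmap complex.
From mathcomp Require Import all_classical all_reals topology normedtype.

Set Implicit Arguments.
Unset Strict Implicit.
Unset Printing Implicit Defensive.

Import Order.TTheory GRing.Theory Num.Theory numFieldNormedType.Exports.

Local Open Scope classical_set_scope.
Local Open Scope ring_scope.
Local Open Scope complex_scope.

(* The cast selects the norm topology that numFieldNormedType puts on any
   numFieldType; the bare type R[i] carries no canonical topology. *)
Notation Cplx R := (R[i] : numFieldType).

Section OperatorNorm.
Context {R : realType} {D : normedModType (Cplx R)}.
Implicit Types (f g h : D -> D) (x : D).

Definition bounded_operator f : Prop :=
  linear f /\ exists M : R, forall x, `|f x| <= M%:C * `|x|.

(* Norms in D are R[i]-valued (with zero imaginary part), whereas suprema are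
   taken in R. *)
Definition opnorm f : R :=
  sup [set complex.Re `|f x| | x in [set x | `|x| <= 1]].

Lemma Re_normK x : (complex.Re `|x|)%:C = `|x|.
Proof. by rewrite RRe_real // normr_real. Qed.

Lemma opnorm_has_sup f : bounded_operator f ->
  has_sup [set complex.Re `|f x| | x in [set x | `|x| <= 1]].
Proof.
move=> [_ [M fM]]; split.
  by exists (complex.Re `|f 0|); exists 0 => //=; rewrite normr0.
exists `|M| => _ [x /= x1 <-]; rewrite -lecR Re_normK.
apply: le_trans (fM x) _; rewrite (@le_trans _ _ (`|M|%:C * `|x|))//.
  by rewrite ler_wpM2r// lecR ler_norm.
by rewrite ler_piMr// ler0c.
Qed.

Lemma bounded_operator0 f : bounded_operator f -> f 0 = 0.
Proof.
by move=> [lf _]; have := lf (-1) 0 0; rewrite scaleN1r oppr0 addr0 scaleN1r addNr.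
Qed.

Lemma bounded_operatorZ f a x : bounded_operator f -> f (a *: x) = a *: f x.
Proof.
by move=> bf; have := bf.1 a x 0; rewrite (bounded_operator0 bf) !addr0.
Qed.

Lemma opnorm_ge0 f : bounded_operator f -> 0 <= opnorm f.
Proof.
move=> bf; apply: ub_le_sup; first exact: (opnorm_has_sup bf).2.
by exists 0; rewrite /= ?normr0 // (bounded_operator0 bf) normr0.
Qed.

Lemma opnormP f x : bounded_operator f -> `|f x| <= (opnorm f)%:C * `|x|.
Proof.
move=> bf; have [->|x0] := eqVneq x 0.
  by rewrite (bounded_operator0 bf) !normr0 mulr0.
have nx0 : 0 < `|x| by rewrite normr_gt0.
rewrite -ler_pdivrMr//.
have -> : `|f x| / `|x| = `|f (`|x|^-1 *: x)|.
  by rewrite (bounded_operatorZ _ _ bf) normrZ normfV normr_id mulrC.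
rewrite -Re_normK lecR; apply: ub_le_sup; first exact: (opnorm_has_sup bf).2.
by exists (`|x|^-1 *: x) => //=; rewrite normrZ normfV normr_id mulVf// gt_eqF.
Qed.

Lemma opnorm_le f (M : R) : 0 <= M ->
  (forall x, `|f x| <= M%:C * `|x|) -> opnorm f <= M.
Proof.
move=> M0 fM; apply: ge_sup.
  by exists (complex.Re `|f 0|); exists 0 => //=; rewrite normr0.
move=> _ [x /= x1 <-]; rewrite -lecR Re_normK (le_trans (fM x))//.
by rewrite ler_piMr// ler0c.
Qed.

Definition bounded_operator_pred : {pred D -> D} :=
  fun f => `[< bounded_operator f >].

Lemma bounded_operator_submod : submod_closed bounded_operator_pred.
Proof.
split=> [|a f g /asboolP[lf [M fM]] /asboolP[lg [N gN]]]; apply/asboolP; split.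
- by move=> b x y; rewrite [RHS]addr0 scaler0.
- by exists 0 => x; rewrite mul0r [leLHS]normr0.
- move=> b x y; rewrite !fctE lf lg !scalerDr !scalerA [a * b]mulrC.
  by rewrite addrACA.
- exists (complex.Re `|a| * M + N) => x.
  apply: le_trans (ler_normD _ _) _.
  have aE : (complex.Re `|a|)%:C = `|a| by rewrite RRe_real ?normr_real.
  rewrite rmorphD rmorphM mulrDl lerD// [X in _ <= X * _ * _]aE.
  by rewrite normrZ -mulrA ler_wpM2l.
Qed.

HB.instance Definition _ :=
  GRing.isSubmodClosed.Build (Cplx R) (D -> D) bounded_operator_pred
    bounded_operator_submod.

Lemma bounded_operator_id : bounded_operator idfun.
Proof. by split=> [a x y//|]; exists 1 => x; rewrite mul1r. Qed.

Lemma bounded_operator_comp f g :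
  bounded_operator f -> bounded_operator g -> bounded_operator (f \o g).
Proof.
move=> bf bg; split=> [a x y /=|]; first by rewrite bg.1 bf.1.
exists (opnorm f * opnorm g) => x /=; rewrite rmorphM -mulrA.
apply: le_trans (opnormP _ bf) _.
by rewrite ler_wpM2l ?ler0c ?opnorm_ge0 ?opnormP.
Qed.

End OperatorNorm.

Record bop (R : realType) (D : normedModType (Cplx R)) := Bop {
  bop_fun :> D -> D;
  bop_subproof : bop_fun \in @bounded_operator_pred R D }.

Section BoundedOperators.
Context {R : realType} {D : normedModType (Cplx R)}.
Implicit Types (S T U : bop D) (x : D).

HB.instance Definition _ := [isSub of bop D for @bop_fun R D].
HB.instance Definition _ := [Choice of bop D by <:].
HB.instance Definition _ := [SubChoice_isSubLmodule of bop D by <:].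

Lemma bopP T : bounded_operator T.
Proof. exact/asboolP/(bop_subproof T). Qed.

Definition bop1 : bop D := Bop (asboolT bounded_operator_id).

Definition bop_mul S T : bop D :=
  Bop (asboolT (bounded_operator_comp (bopP S) (bopP T))).

Lemma bopE S T : (forall x, S x = T x) -> S = T.
Proof. by move=> ST; apply/val_inj/funext. Qed.

Lemma bop_mulA : associative bop_mul. Proof. by move=> S T U; exact: bopE. Qed.

Lemma bop_mul1l : left_id bop1 bop_mul. Proof. by move=> S; exact: bopE. Qed.

Lemma bop_mul1r : right_id bop1 bop_mul. Proof. by move=> S; exact: bopE. Qed.

Lemma bop_mulDl : left_distributive bop_mul +%R.
Proof. by move=> S T U; exact: bopE. Qed.

Lemma bop_mulDr : right_distributive bop_mul +%R.
Proof.
move=> S T U; apply: bopE => x /=; have := (bopP S).1 1 (T x) (U x).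
by rewrite !scale1r.
Qed.

HB.instance Definition _ := GRing.Zmodule_isPzRing.Build (bop D)
  bop_mulA bop_mul1l bop_mul1r bop_mulDl bop_mulDr.

Definition bop_norm T : Cplx R := (opnorm T)%:C.

Lemma bop_normD S T : bop_norm (S + T) <= bop_norm S + bop_norm T.
Proof.
rewrite /bop_norm -rmorphD lecR.
apply: opnorm_le => [|x]; first by rewrite addr_ge0// opnorm_ge0//; exact: bopP.
rewrite rmorphD mulrDl (le_trans (ler_normD _ _))// lerD// opnormP//; exact: bopP.
Qed.

Lemma bop_normZ_le (a : Cplx R) T : bop_norm (a *: T) <= `|a| * bop_norm T.
Proof.
have aE : (complex.Re `|a|)%:C = `|a| by rewrite RRe_real ?normr_real.
have a0 : 0 <= complex.Re `|a| by rewrite -ler0c aE.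
have -> : `|a| * bop_norm T = (complex.Re `|a| * opnorm T)%:C.
  by rewrite rmorphM [X in _ = X * _]aE.
rewrite lecR; apply: opnorm_le => [|x].
  by rewrite mulr_ge0// opnorm_ge0//; exact: bopP.
rewrite rmorphM [X in _ <= X * _ * _]aE [leLHS]normrZ -mulrA ler_wpM2l//.
by apply: opnormP; exact: bopP.
Qed.

Lemma bop_normZ (a : Cplx R) T : bop_norm (a *: T) = `|a| * bop_norm T.
Proof.
apply/le_anti; rewrite bop_normZ_le /=.
have [->|a0] := eqVneq a 0.
  by rewrite normr0 mul0r ler0c opnorm_ge0//; exact: bopP.
rewrite -ler_pdivlMl ?normr_gt0// -normfV.
by have := bop_normZ_le a^-1 (a *: T); rewrite scalerA mulVf// scale1r.
Qed.

Lemma bop_norm0_eq0 T : bop_norm T = 0 -> T = 0.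
Proof.
move=> T0; apply: bopE => x; apply/eqP; rewrite -normr_le0.
by rewrite (le_trans (opnormP x (bopP T)))// [_%:C]T0 mul0r.
Qed.

HB.instance Definition _ :=
  Lmodule_isNormed.Build (Cplx R) (bop D) bop_normD bop_normZ bop_norm0_eq0.

End BoundedOperators.

Section CrossedProducts.
Context {R : realType} {D : completeNormedModType (Cplx R)}.
Context {G : topologicalZmodType}.
Implicit Types (A : set (bop D)) (T : G -> bop D) (F : {fset G}).
Implicit Types (a : G -> bop D) (b : bop D) (g : G).

(* A is not required to contain the identity operator. *)
Definition closed_subalgebra A : Prop :=
  [/\ A 0,
      forall (c : Cplx R) x y, A x -> A y -> A (c *: x + y),
      forall x y, A x -> A y -> A (x * y)
    & closed A].

(* A representation of G as a discrete group: T is not assumed continuous. *)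
Definition isometric_representation T : Prop :=
  [/\ T 0 = 1,
      forall g h, T (g + h) = T g * T h
    & forall g (x : D), `|T g x| = `|x|].

Definition character (chi : G -> Cplx R) : Prop :=
  [/\ continuous chi,
      forall g h, chi (g + h) = chi g * chi h
    & forall g, `|chi g| = 1].

Definition coefs_in A F a : Prop := forall g, g \in F -> A (a g).

Definition finsum_op T F a : bop D := \sum_(g <- F) a g * T g.

Definition coef F a g : bop D := if g \in F then a g else 0.

Definition generated_algebra A T : set (bop D) :=
  closure [set b | exists F a, coefs_in A F a /\ b = finsum_op T F a].

Definition property_star A T : Prop :=
  forall F a, coefs_in A F a -> `|coef F a 0| <= `|finsum_op T F a|.

(* N is the map N_g; by density its values on generated_algebra A T are
   uniquely determined by these three conditions. *)
Definition coefficient_map A T g (N : bop D -> bop D) : Prop :=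
  [/\ forall b, generated_algebra A T b -> A (N b),
      forall F a, coefs_in A F a -> N (finsum_op T F a) = coef F a g
    & {within generated_algebra A T, continuous N}].

Definition property_double_star A T : Prop :=
  property_star A T /\
  exists N : G -> bop D -> bop D,
    (forall g, coefficient_map A T g (N g)) /\
    forall b, generated_algebra A T b -> (b = 0 <-> forall g, N g b = 0).

End CrossedProducts.

(* Main.v *)
Require Import Defs.
From HB Require Import structures.
From mathcomp Require Import all_boot all_order all_algebra.
From mathcomp Require Import finmap complex.
From mathcomp Require Import all_classical all_reals topology normedtype.
From mathcomp Require Import ring lra.

Set Implicit Arguments.
Unset Strict Implicit.
Unset Printing Implicit Defensive.

Import Order.TTheory GRing.Theory Num.Theory numFieldNormedType.Exports.

Local Open Scope classical_set_scope.
Local Open Scope ring_scope.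
Local Open Scope complex_scope.

(** The proof has two independent halves: enough continuous characters exist,
    and averaging over characters produces contractive multipliers.

    Multipliers. The hypothesis says that twisting the coefficients of a finite
    sum by a character does not change its norm; hence multiplying [a g] by
    [sum_i w_i * chi_i g], with weights [w_i >= 0], multiplies the norm by at
    most [sum_i w_i]. The weights [|sum_p f p * chi p| ^+ 2], averaged over the
    characters, produce the positive definite function
    [phi g = sum_p f p * f (p + g)]: indeed, since characters separate points,
    suitable finite averages of characters are as small as desired on a given
    finite set of nonzero elements ([small_char_avg]). So the multiplier [phi]
    has norm at most [phi 0] on finite sums ([multiply_contraction]). If [f] is
    a point mass, [phi] is the indicator of the neutral element, which is
    property star. Applied to [b * T (- g)] it bounds every coefficient, and
    the coefficient maps extend to the closure because the algebra of bounded
    operators is complete. The group is amenable, so there are [phi] with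
    finite support, [phi 0 = 1] and [phi] close to 1 on any given finite set
    ([autocorr_near1]): such a multiplier hardly moves a finite sum close to
    [b], but it makes it small when all the coefficients of [b] vanish. This is
    property double star ([coefficients_separate]).

    Characters. The theorem that the continuous characters of a locally compact
    abelian group separate points is proved here directly. Let [X] be a maximal
    subset whose points are separated by a fixed neighbourhood of 0. Summing a
    function over [X + s], and taking an invariant mean over all [s], gives a
    translation invariant integral on all bounded functions with relatively
    compact support ([dint]). For this integral, compare the squared norm [Q v]
    with the squared norm [gam v] of the correlation of [v] with a continuous
    bump function. Both are invariant under translations, and [gam] is bounded
    by a multiple of [Q] ([dint_corr_le]). By the parallelogram law one can
    localize a vector [v] with [gam v > 0] in the spectrum of finitely many
    translations at once while keeping [gam v / Q v] bounded below
    ([dyadic_localization], [approximate_eigenvectors]). Along an ultrafilter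
    the approximate eigenvalues converge to a homomorphism into the circle. It
    is continuous because translating [v] changes its correlation as little as
    translating the bump function does, and it is not 1 at [g] if [gam v] is
    replaced by [gam (U g v - v)], where [U g] is the translation by [g]
    ([separating_character]). *)

(** * Invariant means on abelian groups *)

Lemma ultra_cvg (T : Type) (X : topologicalType) (u : set_system T)
    (K : set X) (f : T -> X) :
  UltraFilter u -> compact K -> u (f @^-1` K) -> exists2 p, K p & f @ u --> p.
Proof.
move=> uU cK uK; have [p [Kp clp]] := cK (f @ u) _ uK.
exists p => // N Np; have [//|uN] := in_ultra_setVsetC (f @^-1` N) uU.
by have [x []] := clp (~` N) N uN Np.
Qed.

Section InvariantMean.
Context {R : realType} {G : zmodType}.
Implicit Types (l : seq G) (h : G -> R) (g : G) (e M : R).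

Definition avg l h : R := (\sum_(s <- l) h s) / (size l)%:R.

Lemma avgD l h1 h2 : avg l (fun x => h1 x + h2 x) = avg l h1 + avg l h2.
Proof. by rewrite /avg big_split mulrDl. Qed.

Lemma avgZ l (c : R) h : avg l (fun x => c * h x) = c * avg l h.
Proof. by rewrite /avg -mulr_sumr mulrA. Qed.

Lemma avgB l h1 h2 : avg l (fun x => h1 x - h2 x) = avg l h1 - avg l h2.
Proof. by rewrite /avg sumrB mulrBl. Qed.

Lemma avg_ge0 l h : (forall x, 0 <= h x) -> 0 <= avg l h.
Proof. by move=> h0; rewrite divr_ge0// sumr_ge0. Qed.

Lemma avg_cst l (c : R) : (0 < size l)%N -> avg l (fun=> c) = c.
Proof.
move=> l0; rewrite /avg big_const_seq count_predT iter_addr_0 -[c *+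
  _]mulr_natr mulfK//.
by rewrite pnatr_eq0 -lt0n.
Qed.

Lemma avg_norm l h M : 0 <= M -> (forall x, `|h x| <= M) -> `|avg l h| <= M.
Proof.
move=> M0 hM; have [->|l0] := eqVneq l [::].
  by rewrite /avg big_nil mul0r normr0.
rewrite -(@avg_cst l M) ?lt0n ?size_eq0// /avg normrM normfV normr_nat
  ler_wpM2r ?invr_ge0//.
by rewrite (le_trans (ler_norm_sum _ _ _))// ler_sum.
Qed.

Definition almost_invariant l e g : Prop :=
  forall h, (forall x, `|h x| <= 1) ->
    `|avg l h - avg l (fun x => h (x + g))| <= e.

(** The support, with multiplicities, of the convolution of two uniform
    probabilities. *)
Definition convol l1 l2 : seq G := [seq s + t | s <- l1, t <- l2].

Lemma avg_convol l1 l2 h :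
  avg (convol l1 l2) h = avg l1 (fun s => avg l2 (fun t => h (s + t))).
Proof.
rewrite /avg /convol size_allpairs big_allpairs_dep natrM invfM mulrA.
by rewrite -[in RHS]mulr_suml mulrAC.
Qed.

Lemma convolC l1 l2 h : avg (convol l1 l2) h = avg (convol l2 l1) h.
Proof.
rewrite /avg /convol !size_allpairs !big_allpairs_dep exchange_big /= mulnC.
by congr (_ / _); apply: eq_bigr => i _; apply: eq_bigr => j _; rewrite addrC.
Qed.

Lemma almost_invariant_convolr l1 l2 e g :
  0 <= e -> almost_invariant l2 e g -> almost_invariant (convol l1 l2) e g.
Proof.
move=> e0 l2g h h1; rewrite !avg_convol -avgB; apply: avg_norm => // s.
have := l2g (fun t => h (s + t)) (fun t => h1 _).
by under [X in _ - avg _ X]eq_fun do rewrite addrA.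
Qed.

Lemma almost_invariant_convoll l1 l2 e g :
  0 <= e -> almost_invariant l1 e g -> almost_invariant (convol l1 l2) e g.
Proof.
move=> e0 l1g h h1; rewrite convolC [X in _ - X]convolC.
exact: almost_invariant_convolr.
Qed.

Lemma almost_invariant_progression n g :
  almost_invariant [seq g *+ k | k <- iota 0 n.+1] (2 / n.+1%:R) g.
Proof.
move=> h h1; rewrite /avg size_map size_iota -mulrBl !big_map -sumrB.
have -> : \sum_(k <- iota 0 n.+1) (h (g *+ k) - h (g *+ k + g)) =
    h 0 - h (g *+ n.+1).
  rewrite -[iota _ _]/(index_iota 0 n.+1).
  rewrite (eq_bigr (fun k => - (h (g *+ k.+1) - h (g *+ k)))); last first.
    by move=> k _; rewrite opprB -mulrSr.
  by rewrite sumrN telescope_sumr// opprB mulr0n.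
rewrite normrM normfV normr_nat ler_wpM2r ?invr_ge0//.
by rewrite (le_trans (ler_normB _ _))// (@le_trans _ _ (1 + 1))// lerD.
Qed.

(** Convolving averages over long arithmetic progressions makes a finitely
    supported probability that is nearly invariant in several directions at
    once: commutativity lets each factor keep its own invariance. *)
Lemma almost_invariant_seq (S : seq G) e : 0 < e ->
  exists2 l, (0 < size l)%N & forall g, g \in S -> almost_invariant l e g.
Proof.
move=> e0; elim: S => [|g S [l l0 lS]]; first by exists [:: 0].
pose n := Num.trunc (2 / e).
exists (convol [seq g *+ k | k <- iota 0 n.+1] l).
  by rewrite size_allpairs size_map size_iota muln_gt0.
move=> x; rewrite inE => /predU1P[->|xS]; last first.
  by apply: almost_invariant_convolr (ltW e0) _; exact: lS.
apply: almost_invariant_convoll (ltW e0) _ => h h1.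
apply: le_trans (@almost_invariant_progression n g h h1) _.
rewrite ler_pdivrMr// -ler_pdivrMl// mulrC ltW//.
exact: truncnS_gt.
Qed.

Definition bounded_function h : Prop := exists M, forall x, `|h x| <= M.

Definition invariant_mean (m : (G -> R) -> R) : Prop :=
  [/\ forall h1 h2, bounded_function h1 -> bounded_function h2 ->
        m (fun x => h1 x + h2 x) = m h1 + m h2,
      forall c h, bounded_function h -> m (fun x => c * h x) = c * m h,
      forall h, bounded_function h -> (forall x, 0 <= h x) -> 0 <= m h,
      m (fun=> 1) = 1
    & forall h g, bounded_function h -> m (fun x => h (x + g)) = m h].

(** Abelian groups are amenable: a mean is a limit, along an ultrafilter, of
    the averages that become invariant under every translation. *)
Lemma invariant_mean_exists : exists m, invariant_mean m.
Proof.
pose B (i : seq G * R) := [set l | (0 < size l)%N /\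
  forall g, g \in i.1 -> almost_invariant l i.2 g].
have FB : ProperFilter (filter_from [set i : seq G * R | 0 < i.2] B).
  apply: filter_from_proper; first apply: filter_from_filter.
  - by exists ([::], 1) => /=.
  - move=> [S1 e1] [S2 e2] /= e10 e20; exists (S1 ++ S2, Num.min e1 e2) => /=.
      by rewrite lt_min e10.
    move=> l [/= l0 lS]; split; split=> //= g gS h h1.
      by rewrite (le_trans (lS _ _ _ h1))// ?mem_cat ?gS// ge_min lexx.
    by rewrite (le_trans (lS _ _ _ h1))// ?mem_cat ?gS ?orbT// ge_min lexx orbT.
  - by move=> [S e] /= e0; have [l l0 lS] := almost_invariant_seq S e0;
    exists l.
have [u [uU Bu]] := ultraFilterLemma FB.
have uB S e : 0 < e -> u (B (S, e)) by move=> e0; apply: Bu; exists (S, e).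
have cv h : bounded_function h -> cvg ((avg^~ h) @ u).
  move=> [M hM]; have M0 : 0 <= M by exact: le_trans (hM 0).
  have [|p _ hp] := @ultra_cvg _ R u `[- M, M]%classic (avg^~ h) uU
    (@segment_compact _ _ _).
    near=> l; rewrite /= in_itv/= -ler_norml; exact: avg_norm.
  by apply/cvg_ex; exists p.
have bS c h : bounded_function h -> bounded_function (fun x => c * h x).
  by move=> [M hM]; exists (`|c| * M) => x; rewrite normrM ler_wpM2l.
exists (fun h => lim ((avg^~ h) @ u)); split.
- move=> h1 h2 /cv c1 /cv c2; apply/cvg_lim => //.
  under eq_fun do rewrite avgD; exact: cvgD.
- move=> c h /cv ch; apply/cvg_lim => //.
  by under eq_fun do rewrite avgZ; apply: cvgM => //; exact: cvg_cst.
- move=> h /cv ch h0; apply: limr_ge => //; near=> l; exact: avg_ge0.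
- apply/cvg_lim => //; apply: cvg_near_cst; near=> l; apply: avg_cst.
  have : B ([::], 1) l by near: l; exact: uB.
  by case.
- move=> h g bh; apply/cvg_lim => //.
  have [M hM] := bh; pose M' := `|M| + 1.
  have M'0 : 0 < M' by rewrite ltr_pwDr.
  have -> : (avg^~ (fun x => h (x + g))) =
      (fun l => avg l h - (avg l h - avg l (fun x => h (x + g)))).
    by apply/funext => l; rewrite subKr.
  rewrite -[X in _ --> X]subr0; apply: cvgB; first exact: cv.
  apply/cvgr0Pnorm_le => e e0; near=> l.
  have : B ([:: g], e / M') l by near: l; apply: uB; rewrite divr_gt0.
  move=> [_ /(_ g (mem_head _ _) (fun x => M'^-1 * h x))].
  rewrite !avgZ -mulrBr normrM (ger0_norm (ltW _)) ?invr_gt0//.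
  rewrite mulrC ler_pM2r ?invr_gt0//; apply => x.
  rewrite normrM (ger0_norm (ltW _)) ?invr_gt0// ler_pdivrMl// mulr1.
  by rewrite (le_trans (hM x))// (le_trans (ler_norm _))// lerDl.
Unshelve. all: by end_near. Qed.

End InvariantMean.

(** * Approximate joint eigenvectors of a commutative unitary action *)

Section SquaredModulus.
Context {R : realType}.
Implicit Types (z w : R[i]) (r : R).

Definition sqn z : R := complex.Re z ^+ 2 + complex.Im z ^+ 2.

Lemma sqn_ge0 z : 0 <= sqn z.
Proof. by rewrite addr_ge0// sqr_ge0. Qed.

Lemma sqnM z w : sqn (z * w) = sqn z * sqn w.
Proof. by case: z w => [a b] [c d]; rewrite /sqn /=; ring. Qed.

Lemma sqnN z : sqn (- z) = sqn z.
Proof. by case: z => a b; rewrite /sqn /= !sqrrN. Qed.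

Lemma sqn_real r : sqn r%:C = r ^+ 2.
Proof. by rewrite /sqn /= expr0n addr0. Qed.

Lemma sqn1 : sqn 1 = 1.
Proof. by rewrite -[1 in LHS]/(1%:C) sqn_real expr1n. Qed.

Lemma sqn_eq0 z : (sqn z == 0) = (z == 0).
Proof.
by case: z => a b; rewrite /sqn paddr_eq0 ?sqr_ge0// !sqrf_eq0 eq_complex.
Qed.

Lemma sqn_norm z : `|z| ^+ 2 = (sqn z)%:C.
Proof.
case: z => a b; rewrite normc_def -rmorphXn sqr_sqrtr//.
by rewrite addr_ge0// sqr_ge0.
Qed.

Lemma sqn1_norm z : sqn z = 1 -> `|z| = 1.
Proof.
move=> z1; apply/eqP; rewrite -(@pexpr_eq1 _ _ 2)// sqn_norm z1.
by rewrite rmorph1.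
Qed.

Lemma sqn1_sqrt z : sqn z = 1 -> exists2 a : R[i], sqn a = 1 & a ^+ 2 = z.
Proof.
move=> z1; exists (sqrtC z); last exact: sqrtCK.
have : sqn (sqrtC z ^+ 2) == 1 by rewrite sqrtCK z1.
rewrite expr2 sqnM -expr2 sqrf_eq1 => /orP[/eqP//|/eqP aN1].
by have := sqn_ge0 (sqrtC z); rewrite aN1 lerNr oppr0 ler10.
Qed.

End SquaredModulus.

Section JointEigenvectors.
Context {R : realType} {G : zmodType} {V : lmodType R[i]}.
Variable U : G -> V -> V.
Hypothesis UD : forall x v w, U x (v + w) = U x v + U x w.
Hypothesis UZ : forall x (z : R[i]) v, U x (z *: v) = z *: U x v.
Hypothesis UA : forall x y v, U (x + y) v = U x (U y v).
Implicit Types (q : V -> R) (v w : V) (x y g : G) (z : R[i]) (L : seq G).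

Let UB x v w : U x (v - w) = U x v - U x w.
Proof. by rewrite -scaleN1r UD UZ scaleN1r. Qed.

Let UC x y v : U x (U y v) = U y (U x v).
Proof. by rewrite -!UA addrC. Qed.

(** The squared seminorms of (possibly indefinite) invariant inner products:
    sesquilinearity is used through the parallelogram law. *)
Definition quadratic q : Prop :=
  [/\ forall v w, q (v + w) + q (v - w) = 2 * q v + 2 * q w,
      forall z v, q (z *: v) = sqn z * q v
    & forall x v, q (U x v) = q v].

Let quadN q v : quadratic q -> q (- v) = q v.
Proof. by case=> _ qZ _; rewrite -scaleN1r qZ sqnN sqn1 mul1r. Qed.

Let quadD q v w : quadratic q -> (forall v, 0 <= q v) ->
  q (v + w) <= 2 * q v + 2 * q w.
Proof. by case=> <- _ _ q0; rewrite lerDl. Qed.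

Let quadB q v w : quadratic q -> (forall v, 0 <= q v) ->
  q (v - w) <= 2 * q v + 2 * q w.
Proof. by move=> qq q0; rewrite -[q w in leRHS](quadN w qq); exact: quadD. Qed.

Lemma quadratic_sub q1 q2 (r : R) : quadratic q1 -> quadratic q2 ->
  quadratic (fun v => q1 v - r * q2 v).
Proof.
move=> [D1 Z1 U1] [D2 Z2 U2]; split=> *; rewrite ?Z1 ?Z2 ?U1 ?U2//;
  last by ring.
rewrite addrACA -opprD -mulrDr D1 D2; ring.
Qed.

Let half : R[i] := (2^-1 : R)%:C.

Let quad_half q v : quadratic q -> q (half *: v) = 4^-1 * q v.
Proof. by case=> _ qZ _; rewrite qZ sqn_real; congr (_ * _); field. Qed.

(** [w] is obtained from [v] by filtering out all frequencies of the operator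
    [U x] but those near one point of the circle, one binary digit at a time.
    At each digit [v] splits into two halves, of which the one kept carries at
    least half of [phi]. *)
Lemma dyadic_localization q phi m x z v :
  quadratic q -> (forall v, 0 <= q v) -> quadratic phi -> sqn z = 1 ->
  exists w (zeta : R[i]), [/\ sqn zeta = 1,
    w - zeta *: U x w = half ^+ m *: (v - z *: U (x *+ (2 ^ m)%N) v),
    phi v <= 2 ^+ m * phi w
  & forall y z', q (U y w - z' *: w) <= q (U y v - z' *: v)].
Proof.
move=> qq q0 phiq; elim: m z v => [|m IH] z v z1.
  by exists v, z; rewrite expr0 scale1r expn0 mulr1n mul1r; split.
have [a a1 a2] := sqn1_sqrt z1.
set t := x *+ (2 ^ m)%N; pose half_of b := half *: (v + b *: U t v).
have [b [b1 b2 phib]] : exists b, [/\ sqn b = 1,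
  b ^+ 2 = z & phi v <= 2 * phi (half_of b)].
  have phiE : phi (half_of a) + phi (half_of (- a)) = phi v.
    rewrite /half_of !quad_half// -mulrDr scaleNr; have [-> phiZ phiU] := phiq.
    by rewrite phiZ a1 phiU mul1r; field.
  have [le|lt] := leP (phi (half_of (- a))) (phi (half_of a)).
    by exists a; split=> //; rewrite -phiE; lra.
  by exists (- a); rewrite sqnN sqrrN; split=> //; rewrite -phiE; lra.
have [w [zeta [zeta1 wE phiw qw]]] := IH b (half_of b) b1.
exists w, zeta; split=> // [||y z'].
- rewrite wE exprSr -scalerA; congr (_ *: _).
  rewrite -/t /half_of UZ UD UZ -UA scalerA mulrC -scalerA -scalerBr.
  congr (_ *: _); rewrite scalerDr scalerA -expr2 b2 opprD addrA addrK.
  by rewrite /t -mulrnDr expnS mul2n addnn.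
- by rewrite exprS -mulrA (le_trans phib)// ler_wpM2l.
apply: le_trans (qw y z') _; set d := U y v - z' *: v.
have -> : U y (half_of b) - z' *: half_of b = half *: (d + b *: U t d).
  rewrite /half_of /d UZ UD UZ UB UZ [U y (U t v)]UC.
  rewrite [z' *: (half *: _)]scalerA [z' * half]mulrC -scalerA -scalerBr.
  congr (_ *: _); rewrite scalerDr opprD addrACA scalerBr; congr (_ + (_ - _)).
  by rewrite !scalerA mulrC.
have [_ qZ qU] := qq; rewrite quad_half//.
apply: le_trans (ler_wpM2l _ (quadD _ _ qq q0)) _; first by rewrite invr_ge0.
by rewrite qZ b1 qU mul1r -mulrDl mulrA -natrD mulVf ?mul1r// pnatr_eq0.
Qed.

(** The form [gam] measures how much of [v] lives on a prescribed part of the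
    spectrum, whereas [Q] measures all of [v]. Keeping [gam v] above a fixed
    multiple of [Q v] prevents the localized vectors from escaping to the part
    of the spectrum where the eigenvalues need not form a continuous
    character. *)
Section TwoForms.
Variables (Q gam : V -> R) (c : R).
Hypothesis Qq : quadratic Q.
Hypothesis Q0 : forall v, 0 <= Q v.
Hypothesis gamq : quadratic gam.
Hypothesis gam0 : forall v, 0 <= gam v.
Hypothesis c0 : 0 < c.
Hypothesis gam_le : forall v, gam v <= c * Q v.

(** Elements of the group are treated one after the other. Localizing at a new
    element does not increase the defects [Q (U y v - z *: v)] already made
    small, but it may shrink [Q v] by a factor that depends only on the number
    of digits; so the earlier defects are made small beyond that factor. Each
    step also spends a part of the margin between [del] and [del0]. *)
Lemma approximate_eigenvectors (del0 : R) v0 :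
  0 < Q v0 -> del0 * Q v0 <= gam v0 ->
  forall L (del e : R), 0 <= del -> del < del0 -> 0 < e ->
  exists v (zeta : G -> R[i]), [/\ 0 < Q v, del * Q v <= gam v &
    forall x, x \in L -> sqn (zeta x) = 1 /\ Q (U x v - zeta x *: v) <=
      e * Q v].
Proof.
move=> v00 gv0; elim=> [|x L IH] del e del_ge0 deldel0 e0.
  exists v0, (fun=> 1); split=> //; apply: le_trans gv0.
  by rewrite ler_wpM2r// ltW.
pose del1 := (del + del0) / 2; pose tau := del1 - del.
have tau0 : 0 < tau by rewrite /tau /del1; lra.
(* [m] digits give a defect of order [4 ^- m] against a loss of norm of order
   [2 ^- m] *)
have [m mP] : exists m : nat, 4 * c <= 2 ^+ m * (e * tau).
  exists (Num.trunc (4 * c / (e * tau))).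
  rewrite -ler_pdivrMr ?mulr_gt0//; apply: le_trans (ltW (truncnS_gt _)) _.
  by rewrite -natrX ler_nat ltn_expl.
have m0 : 0 < 2 ^+ m :> R by rewrite exprn_gt0.
pose e1 := e * tau / (c * 2 ^+ m).
have e10 : 0 < e1 by rewrite divr_gt0 ?mulr_gt0.
have [||v [zeta [Qv gv zP]]] := IH del1 e1 _ _ e10; [rewrite /del1; lra..|].
have [w [z [z1 wE phiw qw]]] :=
  dyadic_localization m x v Qq Q0 (quadratic_sub del gamq Qq) sqn1.
have phiv : tau * Q v <= gam v - del * Q v by rewrite /tau mulrBl lerD2r.
have {}phiw : tau * Q v <= 2 ^+ m * (gam w - del * Q w) by apply: le_trans phiw.
have Qw_ge : tau * Q v <= 2 ^+ m * (c * Q w).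
  apply: le_trans phiw _; rewrite ler_pM2l// (le_trans _ (gam_le w))//.
  by rewrite gerBl mulr_ge0.
have Qw : 0 < Q w.
  have : 0 < 2 ^+ m * (c * Q w) by apply: lt_le_trans Qw_ge; rewrite mulr_gt0.
  by rewrite !pmulr_rgt0.
exists w, (fun y => if y == x then z^-1 else zeta y); split=> //.
  have : 0 <= 2 ^+ m * (gam w - del * Q w).
    by apply: le_trans phiw; rewrite mulr_ge0// ltW.
  by rewrite pmulr_rge0// subr_ge0.
have z_neq0 : z != 0 by rewrite -sqn_eq0 z1 oner_eq0.
move=> y; rewrite inE; case: eqVneq => [-> _|yx /= yL].
  split.
    by have := sqnM z z^-1; rewrite mulfV// sqn1 z1 mul1r.
  have [_ QZ QU] := Qq.
  have -> : Q (U x w - z^-1 *: w) = Q (w - z *: U x w).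
    have -> : w - z *: U x w = (- z) *: (U x w - z^-1 *: w).
      by rewrite scalerBr scalerA mulNr mulfV// scaleNr scaleN1r opprK addrC.
    by rewrite QZ sqnN z1 mul1r.
  rewrite wE QZ scale1r.
  have QB : Q (v - U (x *+ (2 ^ m)%N) v) <= 4 * Q v.
    by apply: le_trans (quadB _ _ Qq Q0) _; rewrite QU -mulrDl -natrD.
  have -> : sqn (half ^+ m) = (2 ^+ m)^-1 ^+ 2.
    have -> : half ^+ m = ((2^-1 : R) ^+ m)%:C by rewrite rmorphXn.
    by rewrite sqn_real; congr (_ ^+ 2); exact: exprVn.
  apply: le_trans (ler_wpM2l _ QB) _; first exact: sqr_ge0.
  rewrite expr2 -mulrA ler_pdivrMl// ler_pdivrMl//.
  have : (4 * c) * (tau * Q v) <= (2 ^+ m * (e * tau)) * (2 ^+ m * (c * Q w)).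
    by apply: ler_pM => //; rewrite mulr_ge0// ltW.
  rewrite (_ : 4 * c * _ = (c * tau) * (4 * Q v)); last by ring.
  rewrite (_ : _ * (2 ^+ m * (c * Q w)) =
    (c * tau) * (2 ^+ m * (2 ^+ m * (e * Q w)))); last by ring.
  by rewrite ler_pM2l// mulr_gt0.
have [zeta1 zetaP] := zP y yL; split=> //.
apply: le_trans (qw _ _) _; apply: le_trans zetaP _.
have : (e / (c * 2 ^+ m)) * (tau * Q v) <=
  (e / (c * 2 ^+ m)) * (2 ^+ m * (c * Q w)).
  by rewrite ler_wpM2l// ltW// divr_gt0// mulr_gt0.
rewrite (_ : _ * (2 ^+ m * _) = e * Q w); last by field; rewrite !gt_eqF.
by apply: le_trans; rewrite /e1 le_eqVlt; apply/orP; left; apply/eqP; ring.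
Qed.

(** Compactness of the circle makes the approximate eigenvalues converge along
    an ultrafilter, for all elements of the group simultaneously. *)
Lemma joint_eigenvalues (del0 : R) v0 :
  0 < Q v0 -> 0 < del0 -> del0 * Q v0 <= gam v0 ->
  exists2 chi : G -> R[i], (forall x, sqn (chi x) = 1) &
  forall L (e : R), 0 < e -> exists v, [/\ 0 < Q v, del0 / 2 * Q v <= gam v &
    forall x, x \in L -> Q (U x v - chi x *: v) <= e * Q v].
Proof.
move=> Qv0 del00 gv0.
have app := approximate_eigenvectors Qv0 gv0.
pose B (i : seq G * R) := [set p : V * (G -> R[i]) |
  [/\ 0 < Q p.1, del0 / 2 * Q p.1 <= gam p.1 & forall x, x \in i.1 ->
    sqn (p.2 x) = 1 /\ Q (U x p.1 - p.2 x *: p.1) <= i.2 * Q p.1]].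
have FB : ProperFilter (filter_from [set i : seq G * R | 0 < i.2] B).
  apply: filter_from_proper; first apply: filter_from_filter.
  - by exists ([::], 1) => /=.
  - move=> [L1 e1] [L2 e2] /= e10 e20; exists (L1 ++ L2, Num.min e1 e2) => /=.
      by rewrite lt_min e10.
    move=> p [/= Qp gp pL]; split; split=> //= x xL.
      have [|zeta1 le] := pL x; first by rewrite mem_cat xL.
      by split=> //; apply: le_trans le _; rewrite ler_wpM2r ?ge_min ?lexx.
    have [|zeta1 le] := pL x; first by rewrite mem_cat xL orbT.
    by split=> //; apply: le_trans le _; rewrite ler_wpM2r ?ge_min ?lexx ?orbT.
  - move=> [L e] /= e0; have [||v [zeta vP]] := app L (del0 / 2) e _ _ e0.
    + by rewrite ltW// divr_gt0.
    + by rewrite ltr_pdivrMr// mulr_natr mulr2n ltrDl.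
    + by exists (v, zeta).
have [u [uU Bu]] := ultraFilterLemma FB.
have uB L (e : R) : 0 < e -> u (B (L, e)) by move=> e0; apply: Bu;
  exists (L, e).
have unit_itv (a b : R) : a ^+ 2 + b ^+ 2 = 1 -> a \in `[-1, 1].
  move=> ab1; rewrite in_itv/= -ler_norml -(@ler_pXn2r _ 2)// ?nnegrE//.
  by rewrite expr1n real_normK ?num_real// -ab1 lerDl sqr_ge0.
have zetaB x : \forall p \near u, sqn (p.2 x) = 1.
  by apply: filterS (uB [:: x] 1 ltr01) => p [_ _ /(_ x (mem_head _ _))[]].
have cvRe x : exists a : R,
    (fun p : V * (G -> R[i]) => complex.Re (p.2 x)) @ u --> a.
  have [|a _ ?] := @ultra_cvg _ R u `[- 1, 1]%classic
    (fun p => complex.Re (p.2 x)) uU (@segment_compact _ _ _); last by exists a.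
  apply: filterS (zetaB x) => p /= z1; apply: (unit_itv _ (complex.Im (p.2 x))).
  exact: z1.
have cvIm x : exists b : R,
    (fun p : V * (G -> R[i]) => complex.Im (p.2 x)) @ u --> b.
  have [|b _ ?] := @ultra_cvg _ R u `[- 1, 1]%classic
    (fun p => complex.Im (p.2 x)) uU (@segment_compact _ _ _); last by exists b.
  apply: filterS (zetaB x) => p /= z1; apply: (unit_itv _ (complex.Re (p.2 x))).
  by rewrite addrC.
have [a aP] := choice cvRe; have [b bP] := choice cvIm.
pose chi x := Complex (a x) (b x).
have cvB x : (fun p => sqn (p.2 x - chi x)) @ u --> 0.
  have -> : 0 = (a x - a x) ^+ 2 + (b x - b x) ^+ 2
    by rewrite !subrr expr0n addr0.
  have -> : (fun p : V * (G -> R[i]) => sqn (p.2 x - chi x)) =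
      (fun p => (complex.Re (p.2 x) - a x) ^+ 2 +
        (complex.Im (p.2 x) - b x) ^+ 2).
    by apply/funext => p; rewrite /sqn !raddfB.
  under eq_fun do rewrite !expr2; rewrite !expr2.
  by apply: cvgD; apply: cvgM; apply: cvgB => //; exact: cvg_cst.
exists chi => [x|L e e0].
  have cv1 : (fun p => sqn (p.2 x)) @ u --> sqn (chi x).
    by rewrite /sqn; under eq_fun do rewrite !expr2; rewrite !expr2;
      apply: cvgD; apply: cvgM.
  apply: (cvg_unique _ cv1) => //.
  by apply: cvg_near_cst; exact: zetaB.
have nearL : \forall p \near u, forall x, x \in L ->
  sqn (p.2 x - chi x) <= e / 4.
  elim: L => [|x L IH]; first by near=> p.
  near=> p => y; rewrite inE => /predU1P[->|yL].
    near: p; apply: cvgr_le (cvB x) _ _; rewrite divr_gt0//.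
  have : forall x, x \in L -> sqn (p.2 x - chi x) <= e / 4 by near: p.
  exact.
have e40 : 0 < e / 4 by rewrite divr_gt0.
have [p [[Qp gp pL] pc]] := filter_ex (filterI (uB L (e / 4) e40) nearL).
exists p.1; split=> // x xL; have [_ le] := pL _ xL.
have -> : U x p.1 - chi x *: p.1 =
    (U x p.1 - p.2 x *: p.1) + (p.2 x - chi x) *: p.1.
  by rewrite scalerBl addrA subrK.
apply: le_trans (quadD _ _ Qq Q0) _.
have [_ QZ _] := Qq; rewrite QZ.
have := ler_wpM2r (Q0 p.1) (pc _ xL).
set A := sqn _ * _; move: le => /=; set B' := Q (_ - _); lra.
Unshelve. all: by end_near. Qed.

(** The eigenvalues of a common approximate eigenvector multiply: this is why
    the limit is a character of the group. *)
Lemma character_of_eigenvalues (del0 : R) v0 :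
  0 < Q v0 -> 0 < del0 -> del0 * Q v0 <= gam v0 ->
  exists chi : G -> R[i], [/\ forall x, sqn (chi x) = 1,
    forall x y, chi (x + y) = chi x * chi y,
    forall x (eta : R), (forall v, gam (U x v - v) <= eta * Q v) ->
      del0 * sqn (chi x - 1) <= 4 * eta
  & forall x, chi x = 1 -> forall e : R, 0 < e ->
      exists v, [/\ 0 < Q v, del0 / 2 * Q v <= gam v & Q (U x v - v) <=
        e * Q v]].
Proof.
move=> Qv0 del00 gv0; have [chi chi1 chiP] := joint_eigenvalues Qv0 del00 gv0.
have [_ QZ QU] := Qq; have [_ gZ _] := gamq.
exists chi; split=> //.
- move=> x y; apply/eqP; rewrite -subr_eq0 -sqn_eq0 eq_le sqn_ge0 andbT.
  apply/ler_addgt0Pr => e e0; rewrite add0r.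
  have e10 : 0 < e / 10 by rewrite divr_gt0.
  have [v [Qv _ vP]] := chiP [:: x + y; x; y] _ e10.
  rewrite -(ler_pM2r Qv) -QZ.
  pose D (t : G) := U t v - chi t *: v.
  have -> : (chi (x + y) - chi x * chi y) *: v =
      (U x (D y) + chi y *: D x) - D (x + y).
    rewrite /D UA UB UZ !scalerBr scalerBl scalerA [chi y * _]mulrC.
    by rewrite addrA subrK opprB [RHS]addrC addrA subrK.
  apply: le_trans (quadB _ _ Qq Q0) _.
  have := quadD (U x (D y)) (chi y *: D x) Qq Q0; rewrite QU QZ chi1 mul1r.
  have := vP (x + y) (mem_head _ _).
  have := vP x; rewrite !inE eqxx orbT => /(_ isT).
  have := vP y; rewrite !inE eqxx !orbT => /(_ isT).
  rewrite -!/(D _); set q1 := Q (D y); set q2 := Q (D x); set q3 := Q (D _).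
  set q4 := Q (_ + _); set q := Q v; lra.
- move=> x eta etaP; apply/ler_addgt0Pr => e e0.
  have e10 : 0 < e / (4 * c) by rewrite divr_gt0// mulr_gt0.
  have [v [Qv gv vP]] := chiP [:: x] _ e10.
  have {}vP := vP x (mem_head _ _).
  rewrite -(ler_pM2r Qv).
  have -> : del0 * sqn (chi x - 1) * Q v =
    2 * sqn (chi x - 1) * (del0 / 2 * Q v).
    by field.
  apply: le_trans (ler_wpM2l _ gv) _; first by rewrite mulr_ge0 ?sqn_ge0.
  rewrite -mulrA -gZ.
  have -> : (chi x - 1) *: v = (U x v - v) - (U x v - chi x *: v).
    by rewrite scalerBl scale1r opprB [RHS]addrC addrA subrK.
  apply: le_trans (ler_wpM2l _ (quadB _ _ gamq gam0)) _ => //.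
  have := etaP v; have := gam_le (U x v - chi x *: v).
  have := ler_wpM2l (ltW c0) vP.
  have -> : c * (e / (4 * c) * Q v) = e / 4 * Q v by field; rewrite gt_eqF.
  set q1 := gam _; set q2 := c * _; set q3 := gam _; set q := Q v; lra.
- move=> x x1 e e0; have [v [Qv gv vP]] := chiP [:: x] _ e0; exists v;
  split=> //.
  by have := vP x (mem_head _ _); rewrite x1 scale1r.
Qed.

End TwoForms.

(** Applying the previous lemma to [v |-> gam (U g v - v)] instead of [gam]
    keeps the frequencies of the eigenvectors away from those with value 1 at
    [g]. *)
Lemma separating_character q gam (c : R) g v0 :
  quadratic q -> (forall v, 0 <= q v) ->
  quadratic gam -> (forall v, 0 <= gam v) -> 0 < c ->
  (forall v, gam v <= c * q v) -> 0 < gam (U g v0 - v0) ->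
  exists chi : G -> R[i], exists K : R, [/\ forall x, sqn (chi x) = 1,
    forall x y, chi (x + y) = chi x * chi y,
    chi g != 1, 0 < K
  & forall x (eta : R), (forall v, gam (U x v - v) <= eta * q v) ->
      sqn (chi x - 1) <= K * eta].
Proof.
move=> qq q0 gq g0 c0 gc gv0; have [_ qZ qU] := qq.
pose gam1 v := gam (U g v - v).
have gam1q : quadratic gam1.
  have [gD gZ gU] := gq; split.
  - move=> v w; rewrite /gam1 -gD UD UB; congr (gam _ + gam _).
      by rewrite opprD addrACA.
    by rewrite !opprD !opprK addrACA.
  - by move=> z v; rewrite /gam1 UZ -scalerBr gZ.
  - by move=> x v; rewrite /gam1 UC -UB gU.
have q4 v : q (U g v - v) <= 4 * q v.
  by apply: le_trans (quadB _ _ qq q0) _; rewrite qU -mulrDl -natrD.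
have gam1_le v : gam1 v <= 4 * c * q v.
  by rewrite (le_trans (gc _))// [4 * c]mulrC -mulrA ler_pM2l.
have c40 : 0 < 4 * c by rewrite mulr_gt0.
have qv0 : 0 < q v0.
  by rewrite -(pmulr_rgt0 _ c40); exact: lt_le_trans gv0 (gam1_le v0).
pose del := gam1 v0 / q v0.
have del0 : 0 < del by rewrite divr_gt0.
have [|chi [chi1 chiM chie chig]] :=
  character_of_eigenvalues qq q0 gam1q (fun v => g0 _) c40 gam1_le qv0 del0.
  by rewrite divfK// gt_eqF.
(* [gam1] varies under translations at most 4 times as much as [gam] *)
exists chi, (16 / del); split=> //; last 2 first.
- by rewrite divr_gt0.
- move=> x eta etaP; rewrite mulrAC ler_pdivlMr// mulrC.
  have -> : 16 * eta = 4 * (4 * eta) by ring.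
  apply: chie => v; have -> : gam1 (U x v - v) =
    gam (U x (U g v - v) - (U g v - v)).
    by rewrite /gam1 !UB [U g (U x v)]UC !opprD !opprK addrACA.
  have eta0 : 0 <= eta.
    by rewrite -(pmulr_lge0 _ qv0) (le_trans (g0 _) (etaP v0)).
  apply: le_trans (etaP _) _; rewrite -mulrA mulrCA.
  by rewrite ler_wpM2l.
apply/eqP => /chig /(_ (del / (4 * c))).
rewrite divr_gt0// => /(_ isT)[v [qv gv]].
rewrite -(ler_pM2l c0) => qe.
have := le_trans gv (le_trans (gc _) qe).
have -> : c * (del / (4 * c) * q v) = del / 4 * q v by field; rewrite gt_eqF.
rewrite ler_pM2r// ler_pM2l// lef_pV2 ?posrE//.
by rewrite ler_nat.
Qed.

End JointEigenvectors.

(** * An invariant integral from a uniformly discrete set *)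

Section DeloneIntegral.
Context {R : realType} {G : zmodType}.
Variables (m : (G -> R) -> R) (W X : set G) (H : seq G).
Hypothesis mP : invariant_mean m.
Hypothesis WN : forall x, W x -> W (- x).
Hypothesis WD : forall x y, W x -> W y -> exists2 h, h \in H & W (x + y - h).
Hypothesis XW : forall x y t, X x -> X y -> W (x - t) -> W (y - t) -> x = y.
Implicit Types (f u k : G -> R) (E : seq G) (x y s t g : G) (M c : R).

Let mD h1 h2 : bounded_function h1 -> bounded_function h2 ->
  m (fun x => h1 x + h2 x) = m h1 + m h2.
Proof. by have [+ _ _ _ _] := mP; exact. Qed.

Let mZ c h : bounded_function h -> m (fun x => c * h x) = c * m h.
Proof. by have [_ + _ _ _] := mP; exact. Qed.

Let m_ge0 h : bounded_function h -> (forall x, 0 <= h x) -> 0 <= m h.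
Proof. by have [_ _ + _ _] := mP; exact. Qed.

Let m_cst c : m (fun=> c) = c.
Proof.
have [_ _ _ m1 _] := mP; rewrite -[RHS]mulr1 -m1 -mZ; last by exists 1 => _;
  rewrite normr1.
by under [in RHS]eq_fun do rewrite mulr1.
Qed.

Let m_le h1 h2 : bounded_function h1 -> bounded_function h2 ->
  (forall x, h1 x <= h2 x) -> m h1 <= m h2.
Proof.
move=> b1 b2 h12; have [M1 hM1] := b1; have [M2 hM2] := b2.
have bN : bounded_function (fun x => -1 * h1 x).
  by exists M1 => x; rewrite mulN1r normrN.
rewrite -subr_ge0 -[- _]mulN1r -mZ// -mD//; apply: m_ge0.
  exists (M2 + M1) => x; rewrite (le_trans (ler_normD _ _))// lerD//.
  by rewrite mulN1r normrN.
by move=> x; rewrite mulN1r subr_ge0.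
Qed.

(** Smallness of the support is measured by the number of translates of [W]
    that cover it: a translate of [W] contains at most one point of [X]. *)
Definition covered E f : Prop :=
  forall y, f y != 0 -> exists2 e, e \in E & W (y - e).

Definition tame f : Prop := bounded_function f /\ exists E, covered E f.

Let near_set E t : set G :=
  [set x | X x /\ exists2 e, e \in E & W (x - t - e)].

Let near_set_finite E t : finite_set (near_set E t).
Proof.
elim: E => [|e E IH].
  by rewrite (_ : near_set _ _ = set0)// -subset0 => x [_ []].
have -> : near_set (e :: E) t =
    [set x | X x /\ W (x - t - e)] `|` near_set E t.
  apply/seteqP; split=> x.
    by move=> [Xx [e' /[!inE] /predU1P[->|e'E] We']]; [left|right; split=> //;
      exists e'].
  move=> [[Xx We]|[Xx [e' e'E We']]]; split=> //.
    by exists e => //; exact: mem_head.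
  by exists e' => //; rewrite inE e'E orbT.
rewrite finite_setU; split=> //.
have [[x0 [Xx0 Wx0]]|nx] := pselect ([set x | X x /\ W (x - t - e)] !=set0).
  apply: (@sub_finite_set _ _ [set x0]) => [x [Xx Wx]|];
    last exact: finite_set1.
  by apply: (@XW x x0 (t + e)) => //; rewrite opprD addrA.
by move/set0P/negP/negPn/eqP: nx => ->; exact: finite_set0.
Qed.

Let near_points E t : seq G := fset_set (near_set E t).

Let near_pointsP E t x : reflect (near_set E t x) (x \in near_points E t).
Proof. by rewrite in_fset_set//; apply: (iffP idP); rewrite inE. Qed.

Let size_near_points E t : (size (near_points E t) <= size E)%N.
Proof.
have ch x : exists e, x \in near_points E t -> e \in E /\ W (x - t - e).
  have [xE|_] := boolP (x \in near_points E t); last by exists 0.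
  by have /near_pointsP[_ [e]] := xE; exists e.
have [c cP] := choice ch.
rewrite -(size_map c); apply: uniq_leq_size.
  rewrite map_inj_in_uniq ?fset_uniq// => x y xE yE cxy.
  have [_ Wx] := cP _ xE; have [_ Wy] := cP _ yE.
  have /near_pointsP[Xx _] := xE; have /near_pointsP[Xy _] := yE.
  by apply: (@XW x y (t + c x)) => //; rewrite opprD addrA// cxy.
by move=> _ /mapP[x xE ->]; have [] := cP _ xE.
Qed.

Let sumX f s : R := \sum_(x \in X) f (x + s).

Let sumXE E f s : covered E f ->
  sumX f s = \sum_(x <- near_points E (- s)) f (x + s).
Proof.
move=> Ef; rewrite /sumX (fsbigE (near_points E (- s))) ?fset_uniq//.
- rewrite big_seq_cond [RHS]big_seq; apply: eq_bigl => x.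
  by apply: andb_idr => /near_pointsP[Xx _]; rewrite inE.
- by move=> x /= /near_pointsP[].
move=> x Xx; apply: contraNeq => /Ef[e eE We]; apply/near_pointsP; split=> //.
by exists e => //; rewrite opprK.
Qed.

Let sumX_norm E f M s : covered E f -> (forall x, `|f x| <= M) ->
  `|sumX f s| <= M * (size E)%:R.
Proof.
move=> Ef fM; have M0 : 0 <= M by exact: le_trans (fM 0).
rewrite (sumXE _ Ef) (le_trans (ler_norm_sum _ _ _))//.
apply: (@le_trans _ _ (\sum_(x <- near_points E (- s)) M));
  first exact: ler_sum.
rewrite big_const_seq count_predT iter_addr_0 -[M *+ _]mulr_natr ler_wpM2l//.
by rewrite ler_nat size_near_points.
Qed.

Let bsumX f : tame f -> bounded_function (sumX f).
Proof.
by move=> [[M fM] [E Ef]]; exists (M * (size E)%:R) => s; exact: sumX_norm.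
Qed.

(** The separated set [X] plays the role of a lattice: summing over a
    translate of it and averaging over all translates is an invariant integral.
    It is defined on all bounded functions with small support, continuous or
    not. *)
Definition dint f : R := m (sumX f).

Lemma coveredS E1 E2 f : {subset E1 <= E2} -> covered E1 f -> covered E2 f.
Proof. by move=> E12 Ef y /Ef[e eE We]; exists e => //; exact: E12. Qed.

Lemma tame0 : tame (fun=> 0).
Proof.
by split; [exists 0 => x; rewrite normr0|exists [::] => y; rewrite eqxx].
Qed.

Lemma tameD f u : tame f -> tame u -> tame (fun x => f x + u x).
Proof.
move=> [[M fM] [E Ef]] [[M' uM] [E' Eu]]; split.
  by exists (M + M') => x; rewrite (le_trans (ler_normD _ _))// lerD.
exists (E ++ E') => y; have [f0|f0 _] := eqVneq (f y) 0.
  rewrite f0 add0r => /Eu[e eE We].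
  by exists e => //; rewrite mem_cat eE orbT.
by have [e eE We] := Ef _ f0; exists e => //; rewrite mem_cat eE.
Qed.

Lemma tameMl f u : bounded_function f -> tame u -> tame (fun x => f x * u x).
Proof.
move=> [M fM] [[M' uM] [E' Eu]]; split.
  by exists (M * M') => x; rewrite normrM ler_pM.
exists E' => y; rewrite mulf_eq0 negb_or => /andP[_]; exact: Eu.
Qed.

Lemma tameZ c f : tame f -> tame (fun x => c * f x).
Proof. by move=> tf; apply: (@tameMl (fun=> c)) => //; exists `|c|. Qed.

Lemma tame_sqr f : tame f -> tame (fun x => f x ^+ 2).
Proof.
by move=> tf; under eq_fun do rewrite expr2; apply: tameMl => //; case: tf.
Qed.

Lemma tame_shift f g : tame f -> tame (fun x => f (x + g)).
Proof.
move=> [[M fM] [E Ef]]; split; first by exists M.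
exists [seq e - g | e <- E] => y /Ef[e eE We].
exists (e - g); first exact: map_f.
by rewrite opprB addrCA addrA [g + y]addrC.
Qed.

Lemma tameB f u : tame f -> tame u -> tame (fun x => f x - u x).
Proof.
move=> tf tu; under eq_fun do rewrite -mulN1r.
by apply: tameD => //; exact: tameZ.
Qed.

Lemma tame_sum (I : Type) (r : seq I) (F : I -> G -> R) :
  (forall i, tame (F i)) -> tame (fun x => \sum_(i <- r) F i x).
Proof.
move=> tF; elim: r => [|i r IH].
  by under eq_fun do rewrite big_nil; exact: tame0.
by under eq_fun do rewrite big_cons; exact: tameD.
Qed.

Lemma dintD f u : tame f -> tame u ->
  dint (fun x => f x + u x) = dint f + dint u.
Proof.
move=> tf tu; rewrite /dint -mD; try exact: bsumX.
congr m; apply/funext => s.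
have [_ [E Ef]] := tf; have [_ [E' Eu]] := tu.
have Ef' : covered (E ++ E') f by apply: coveredS Ef => x;
  rewrite mem_cat => ->.
have Eu' : covered (E ++ E') u.
  by apply: coveredS Eu => x; rewrite mem_cat orbC => ->.
rewrite (sumXE _ Ef') (sumXE _ Eu') -big_split; apply: sumXE => y.
have [f0|f0 _] := eqVneq (f y) 0; last exact: Ef'.
by rewrite f0 add0r; exact: Eu'.
Qed.

Lemma dintZ c f : tame f -> dint (fun x => c * f x) = c * dint f.
Proof.
move=> tf; rewrite /dint -mZ; last exact: bsumX.
by congr m; apply/funext => s; rewrite /sumX mulr_fsumr.
Qed.

Lemma dintB f u : tame f -> tame u ->
  dint (fun x => f x - u x) = dint f - dint u.
Proof.
move=> tf tu; under eq_fun do rewrite -mulN1r.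
by rewrite dintD ?dintZ ?mulN1r//; exact: tameZ.
Qed.

Lemma dint0 : dint (fun=> 0) = 0.
Proof.
rewrite (_ : (fun _ => _) = fun x => 0 * (fun=> 0) x).
  by rewrite dintZ ?mul0r//; exact: tame0.
by apply/funext => x; rewrite mul0r.
Qed.

Lemma dint_sum (I : Type) (r : seq I) (F : I -> G -> R) :
  (forall i, tame (F i)) ->
  dint (fun x => \sum_(i <- r) F i x) = \sum_(i <- r) dint (F i).
Proof.
move=> tF; elim: r => [|i r IH].
  rewrite big_nil -[RHS]dint0.
  by congr dint; apply/funext => x; rewrite big_nil.
rewrite big_cons -IH -dintD//; last exact: tame_sum.
by congr dint; apply/funext => x; rewrite big_cons.
Qed.

Lemma dint_ge0 f : tame f -> (forall x, 0 <= f x) -> 0 <= dint f.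
Proof. by move=> tf f0; apply: m_ge0 (bsumX tf) _ => s; exact: fsumr_ge0. Qed.

Lemma dint_le f u : tame f -> tame u -> (forall x, f x <= u x) ->
  dint f <= dint u.
Proof.
move=> tf tu fu; rewrite -subr_ge0 -dintB//; apply: dint_ge0;
  first exact: tameB.
by move=> x; rewrite subr_ge0.
Qed.

Lemma dint_shift f g : tame f -> dint (fun x => f (x + g)) = dint f.
Proof.
move=> tf; have [_ _ _ _ mT] := mP; rewrite /dint -(mT _ g (bsumX tf)).
by congr m; apply/funext => s; apply: eq_fsbigr => x _; rewrite addrA.
Qed.

Lemma dint_ge f c : tame f -> (forall x, 0 <= f x) ->
  (forall s, exists2 x, X x & c <= f (x + s)) -> c <= dint f.
Proof.
move=> tf f0 fc; rewrite -[leLHS]m_cst; apply: m_le (bsumX tf) _.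
  by exists `|c|.
move=> s; have [x Xx cx] := fc s; have [_ [E Ef]] := tf.
have [fx0|cN0] := eqVneq (f (x + s)) 0.
  by apply: le_trans cx _; rewrite fx0; exact: fsumr_ge0.
rewrite (sumXE _ Ef) (big_rem x)/=; last first.
  apply/near_pointsP; split=> //; have [e eE We] := Ef _ cN0.
  by exists e => //; rewrite opprK.
by rewrite (le_trans cx)// lerDl sumr_ge0.
Qed.

Lemma dint_norm E f M : covered E f -> (forall x, `|f x| <= M) ->
  `|dint f| <= M * (size E)%:R.
Proof.
move=> Ef fM; have tf : tame f by split; [exists M|exists E].
have bc c : bounded_function (fun _ : G => c) by exists `|c|.
have fN s := sumX_norm s Ef fM.
rewrite ler_norml; apply/andP; split.
  rewrite -[leLHS]m_cst; apply: m_le (bsumX tf) _ => // s.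
  by move: (fN s); rewrite ler_norml => /andP[].
rewrite -[leRHS]m_cst; apply: m_le => // [|s]; first exact: bsumX.
by move: (fN s); rewrite ler_norml => /andP[].
Qed.

Lemma dint_cauchy_schwarz f u : tame f -> tame u ->
  dint (fun x => f x * u x) ^+ 2 <=
    dint (fun x => f x ^+ 2) * dint (fun x => u x ^+ 2).
Proof.
move=> tf tu; have tfu : tame (fun x => f x * u x) by apply: tameMl => //;
  case: tf.
set a := dint (fun x => f x ^+ 2); set b := dint (fun x => f x * u x).
set c := dint (fun x => u x ^+ 2).
have disc (t : R) : 0 <= t ^+ 2 * a + (- (2 * t) * b + c).
  have <- : dint (fun x => (t * f x - u x) ^+ 2) =
      t ^+ 2 * a + (- (2 * t) * b + c).
    rewrite /a /b /c -!dintZ//; last exact: tame_sqr.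
    rewrite -!dintD//; do ?[exact: tfu | exact: tame_sqr | apply: tameZ |
      apply: tameD].
    by congr dint; apply/funext => x; ring.
  apply: dint_ge0 => [|x]; last exact: sqr_ge0.
  by apply: tame_sqr; apply: tameB => //; exact: tameZ.
have a0 : 0 <= a by apply: dint_ge0; [exact: tame_sqr|move=> x; exact: sqr_ge0].
have [a0'|a_neq0] := eqVneq a 0.
  have [b0|b0] := eqVneq b 0; first by rewrite b0 a0' mul0r expr0n.
  have := disc ((c + 1) / (2 * b)); rewrite a0'.
  have -> : ((c + 1) / (2 * b)) ^+ 2 * 0 + (- (2 * ((c + 1) / (2 * b))) * b +
    c) = -1.
    by field.
  by rewrite lerNr oppr0 ler10.
have a_gt0 : 0 < a by rewrite lt_neqAle eq_sym a_neq0.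
have := disc (b / a).
have -> : (b / a) ^+ 2 * a + (- (2 * (b / a)) * b + c) = (a * c - b ^+ 2) / a.
  by field.
by rewrite pmulr_lge0 ?invr_gt0// subr_ge0.
Qed.

(** Correlation with [k], i.e. convolution with the reflection of [k]. *)
Definition corr k u x : R := dint (fun y => k (y - x) * u y).

(** The correlation of two functions lives on differences of elements of their
    supports, which stay small because [W + W] is covered by finitely many
    translates of [W]. *)
Let sub_covered E1 E2 : exists E, forall x y,
  (exists2 e, e \in E1 & W (y - x - e)) ->
  (exists2 e, e \in E2 & W (y - e)) -> exists2 e, e \in E & W (x - e).
Proof.
exists [seq e.2 - e.1 + h | e <- [seq (a, b) | a <- E1, b <- E2], h <- H].
move=> x y [a aE Wa] [b bE Wb]; have [h hH Wh] := WD Wb (WN Wa).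
exists (b - a + h).
  by apply/allpairsP; exists ((a, b), h) => /=; split=> //; exact: allpairs_f.
suff -> : x - (b - a + h) = y - b - (y - x - a) - h by [].
rewrite opprD addrA; congr (_ - h).
by rewrite [RHS]addrAC -[y - x - a]addrA -opprD subKr opprB addrA.
Qed.

Lemma tame_kernel k x : tame k -> tame (fun y => k (y - x)).
Proof. exact: tame_shift. Qed.

Lemma corrD k u1 u2 x : tame k -> tame u1 -> tame u2 ->
  corr k (fun y => u1 y + u2 y) x = corr k u1 x + corr k u2 x.
Proof.
move=> tk t1 t2; have [bk _] := tame_kernel x tk.
rewrite /corr -dintD; [|exact: tameMl..].
by congr dint; apply/funext => y; rewrite mulrDr.
Qed.

Lemma corrZ k u c x : tame k -> tame u ->
  corr k (fun y => c * u y) x = c * corr k u x.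
Proof.
move=> tk tu; have [bk _] := tame_kernel x tk.
rewrite /corr -dintZ; last exact: tameMl.
by congr dint; apply/funext => y; rewrite mulrCA.
Qed.

Lemma corr_shift k u g x : tame k -> tame u ->
  corr k (fun y => u (y + g)) x = corr k u (x + g).
Proof.
move=> tk tu; have [bk _] := tame_kernel (x + g) tk.
rewrite /corr -[RHS](dint_shift g); last exact: tameMl.
by congr dint; apply/funext => y; rewrite opprD addrACA subrr addr0.
Qed.

Let kernel_covered E1 E2 : exists E, forall k u v,
  covered E1 k -> covered E2 u ->
  (forall x, v x != 0 -> exists y, k (y - x) != 0 /\ u y != 0) -> covered E v.
Proof.
have [E EP] := sub_covered E1 E2; exists E => k u v Ek Eu vk x /vk[y [ky uy]].
by apply: (EP x y); [exact: Ek|exact: Eu].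
Qed.

Let dint_neq0 f : tame f -> dint f != 0 -> exists y, f y != 0.
Proof.
move=> tf; apply: contra_neqP => /forallNP f0.
suff -> : f = fun=> 0 by exact: dint0.
by apply/funext => x; apply/eqP; apply: contrapT => /negP; exact: f0.
Qed.

Lemma tame_corr k u : tame k -> tame u -> tame (corr k u).
Proof.
move=> tk tu; have [[K kK] [E1 Ek]] := tk; have [[M uM] [E2 Eu]] := tu.
split.
  exists (K * M * (size E2)%:R) => x; apply: dint_norm => [y|y].
    by rewrite mulf_eq0 negb_or => /andP[_]; exact: Eu.
  by rewrite normrM ler_pM.
have [E EP] := kernel_covered E1 E2; exists E; apply: EP Ek Eu _ => x.
have [bk _] := tame_kernel x tk.
move=> /(dint_neq0 (tameMl bk tu))[y].
by rewrite mulf_eq0 negb_or => /andP[ky uy]; exists y.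
Qed.

(** Young's inequality. The integral is merely finitely additive, so Fubini's
    theorem may fail for it; but the outer integral is an average of finite
    sums over [X], and finite sums can be moved inside the inner integral,
    where separation bounds the number of nonzero terms. *)
Lemma dint_corr_le E k u : tame k -> covered E k -> tame u ->
  dint (fun x => corr k u x ^+ 2) <=
  dint (fun x => k x ^+ 2) * (size E)%:R * dint (fun x => u x ^+ 2).
Proof.
move=> tk Ek tu; have [[K kK] _] := tk; have [[M uM] [E2 Eu]] := tu.
pose i (x y : G) : R := (k (y - x) != 0)%:R.
have bi x : bounded_function (i x).
  by exists 1 => y; rewrite /i normr_nat lern1 leq_b1.
pose q x y := i x y * u y ^+ 2.
have tq x : tame (q x) by apply: tameMl => //; exact: tame_sqr.
pose F x := dint (q x).
have tF : tame F.
  split.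
    exists (M ^+ 2 * (size E2)%:R) => x; apply: dint_norm => [y|y].
      rewrite mulf_eq0 negb_or => /andP[_]; rewrite sqrf_eq0; exact: Eu.
    rewrite normrM normrX -[leRHS]mul1r; apply: ler_pM => //.
    - by rewrite exprn_ge0.
    - by rewrite /i normr_nat lern1 leq_b1.
    - by rewrite lerXn2r ?nnegrE// (le_trans _ (uM y)).
  have [E' EP] := kernel_covered E E2; exists E'; apply: EP Ek Eu _ => x.
  move=> /(dint_neq0 (tq x))[y];
    rewrite /q mulf_eq0 negb_or sqrf_eq0 => /andP[iy uy].
  by exists y; split=> //; move: iy; rewrite /i; case: (k _ != 0) => //;
    rewrite eqxx.
have u2_ge0 : 0 <= dint (fun x => u x ^+ 2).
  by apply: dint_ge0; [exact: tame_sqr|move=> x; exact: sqr_ge0].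
have FE : dint F <= (size E)%:R * dint (fun x => u x ^+ 2).
  rewrite /dint -[leRHS]m_cst; apply: m_le (bsumX tF) _ _ => [|s].
    by eexists => _.
  have [_ [E' EF]] := tF; rewrite (sumXE _ EF) -dint_sum//.
  rewrite -dintZ; last exact: tame_sqr.
  apply: dint_le => [||y]; [exact: tame_sum|by apply: tameZ; exact: tame_sqr|].
  rewrite -mulr_suml ler_wpM2r ?sqr_ge0//.
  rewrite -natr_sum ler_nat -(big_map _ predT id) -sumnE sumn_count.
  rewrite -size_filter -(size_map -%R E).
  apply: leq_trans (size_near_points _ (y - s)).
  apply: uniq_leq_size => [|x]; first by rewrite filter_uniq ?fset_uniq.
  rewrite mem_filter => /andP[/Ek[e eE We] /near_pointsP[Xx _]].
  apply/near_pointsP; split=> //; exists (- e); first exact: map_f.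
  rewrite opprK opprB addrA; suff -> : x + s - y + e = - (y - (x + s) - e).
    exact: WN.
  by rewrite !opprB; exact: addrC.
rewrite -mulrA; apply: le_trans (ler_wpM2l _ FE).
  rewrite -dintZ//; apply: dint_le => [||x].
  - by apply: tame_sqr; exact: tame_corr.
  - exact: tameZ.
  have [bk _] := tame_kernel x tk.
  have <- : dint (fun y => k (y - x) ^+ 2) = dint (fun x => k x ^+ 2).
    by rewrite -[RHS](dint_shift (- x))//; exact: tame_sqr.
  have -> : corr k u x = dint (fun y => k (y - x) * (i x y * u y)).
    congr dint; apply/funext => y; rewrite /i.
    by have [->|_] := eqVneq (k (y - x)) 0; rewrite ?mul0r// mul1r.
  have -> : F x = dint (fun y => (i x y * u y) ^+ 2).
    congr dint; apply/funext => y; rewrite /q exprMn /i.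
    by case: (k _ != 0); rewrite ?expr0n ?expr1n.
  apply: dint_cauchy_schwarz; first exact: tame_kernel.
  exact: tameMl.
by apply: dint_ge0; [exact: tame_sqr|move=> x; exact: sqr_ge0].
Qed.

(** * Quadratic forms on the regular representation *)

(** The regular representation, on complex functions with tame real and
    imaginary parts. *)
Definition tame_complex : {pred G -> R[i]^o} :=
  fun v => `[< tame (fun x => complex.Re (v x)) /\ tame (fun x =>
    complex.Im (v x)) >].

Lemma tame_complex_submod : submod_closed tame_complex.
Proof.
split=> [|a u v /asboolP[ru iu] /asboolP[rv iv]]; apply/asboolP.
  by split; exact: tame0.
split.
  rewrite (_ : (fun _ => _) = fun x => (complex.Re a * complex.Re (u x) -
    complex.Im a * complex.Im (u x)) + complex.Re (v x)).
    by apply: tameD => //; apply: tameB; exact: tameZ.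
  by apply/funext => x; rewrite !fctE raddfD /=; case: a (u x) => [a b] [c d].
rewrite (_ : (fun _ => _) = fun x => (complex.Re a * complex.Im (u x) +
  complex.Im a * complex.Re (u x)) + complex.Im (v x)).
  by apply: tameD => //; apply: tameD; exact: tameZ.
by apply/funext => x; rewrite !fctE raddfD /=; case: a (u x) => [a b] [c d].
Qed.

HB.instance Definition _ :=
  GRing.isSubmodClosed.Build R[i] (G ->
    R[i]^o) tame_complex tame_complex_submod.

Record tame_fun := TameFun {
  tame_val :> G -> R[i]^o;
  tame_valP : tame_val \in tame_complex }.

HB.instance Definition _ := [isSub of tame_fun for tame_val].
HB.instance Definition _ := [Choice of tame_fun by <:].
HB.instance Definition _ := [SubChoice_isSubLmodule of tame_fun by <:].

Implicit Types v w : tame_fun.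

Definition re_part v x : R := complex.Re (v x).
Definition im_part v x : R := complex.Im (v x).

Lemma tame_re v : tame (re_part v).
Proof. by case/asboolP: (tame_valP v). Qed.

Lemma tame_im v : tame (im_part v).
Proof. by case/asboolP: (tame_valP v). Qed.

Lemma translate_subproof g v : (fun x => v (x + g)) \in tame_complex.
Proof.
apply/asboolP; split; first exact: (tame_shift g (tame_re v)).
exact: (tame_shift g (tame_im v)).
Qed.

Definition translate g v : tame_fun := TameFun (translate_subproof g v).

Lemma tame_funE v w : (forall x, v x = w x) -> v = w.
Proof. by move=> vw; apply/val_inj/funext. Qed.

Lemma translateD g v w : translate g (v + w) = translate g v + translate g w.
Proof. exact: tame_funE. Qed.

Lemma translateZ g (z : R[i]) v : translate g (z *: v) = z *: translate g v.
Proof. exact: tame_funE. Qed.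

Lemma translateA g h v : translate (g + h) v = translate g (translate h v).
Proof. by apply: tame_funE => x /=; rewrite addrA. Qed.

Section OperatorForm.
Variable L : (G -> R) -> G -> R.
Hypothesis Ltame : forall u, tame u -> tame (L u).
Hypothesis LD : forall u1 u2 x, tame u1 -> tame u2 ->
  L (fun y => u1 y + u2 y) x = L u1 x + L u2 x.
Hypothesis LZ : forall u c x, tame u -> L (fun y => c * u y) x = c * L u x.
Hypothesis Lshift : forall u g x, tame u ->
  L (fun y => u (y + g)) x = L u (x + g).

(** The squared L^2 norm of [L v], for [L] extended complex linearly. *)
Definition form v : R :=
  dint (fun x => L (re_part v) x ^+ 2 + L (im_part v) x ^+ 2).

Let tame_form v : tame (fun x => L (re_part v) x ^+ 2 + L (im_part v) x ^+ 2).
Proof.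
by apply: tameD; apply: tame_sqr; apply: Ltame; [exact: tame_re|exact: tame_im].
Qed.

Lemma form_ge0 v : 0 <= form v.
Proof. by apply: dint_ge0 => // x; rewrite addr_ge0 ?sqr_ge0. Qed.

Let L_lin u1 u2 (a b : R) x : tame u1 -> tame u2 ->
  L (fun y => a * u1 y + b * u2 y) x = a * L u1 x + b * L u2 x.
Proof. by move=> t1 t2; rewrite LD ?LZ//; exact: tameZ. Qed.

Lemma form_quadratic : quadratic translate form.
Proof.
have tr := tame_re; have ti := tame_im.
split=> [v w|z v|g v].
- rewrite /form -!dintZ// -!dintD//; do ?exact: tameZ.
  congr dint; apply/funext => x.
  have reD : re_part (v + w) = fun y => 1 * re_part v y + 1 * re_part w y.
    by apply/funext => y; rewrite !mul1r; exact: raddfD.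
  have imD : im_part (v + w) = fun y => 1 * im_part v y + 1 * im_part w y.
    by apply/funext => y; rewrite !mul1r; exact: raddfD.
  have reB : re_part (v - w) = fun y => 1 * re_part v y + -1 * re_part w y.
    by apply/funext => y; rewrite mul1r mulN1r; exact: raddfB.
  have imB : im_part (v - w) = fun y => 1 * im_part v y + -1 * im_part w y.
    by apply/funext => y; rewrite mul1r mulN1r; exact: raddfB.
  by rewrite reD imD reB imB !L_lin//; ring.
- rewrite /form -dintZ//; congr dint; apply/funext => x.
  have -> : re_part (z *: v) =
      fun y => complex.Re z * re_part v y + (- complex.Im z) * im_part v y.
    apply/funext => y; rewrite mulNr /re_part /im_part.
    by have -> : (z *: v) y = z * v y by []; case: z (v y) => [a b] [c d].
  have -> : im_part (z *: v) =
      fun y => complex.Im z * re_part v y + complex.Re z * im_part v y.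
    apply/funext => y; rewrite addrC /re_part /im_part.
    by have -> : (z *: v) y = z * v y by []; case: z (v y) => [a b] [c d].
  by rewrite !L_lin// /sqn; ring.
rewrite /form -[RHS](dint_shift g)//; congr dint; apply/funext => x.
by rewrite -!Lshift.
Qed.

End OperatorForm.

(** The two quadratic forms compared are the squared norms of [v] and of its
    correlation with [k]. The latter is dominated by the former, and it varies
    continuously under translation because a translation of [v] can be moved to
    the continuous function [k]. *)
Lemma character_of_kernel (k u0 : G -> R) E g :
  tame k -> covered E k -> tame u0 ->
  0 < dint (fun x => corr k (fun y => u0 (y + g) - u0 y) x ^+ 2) ->
  exists chi : G -> R[i], exists2 K : R, 0 <= K &
  [/\ forall x, sqn (chi x) = 1, forall x y, chi (x + y) = chi x * chi y,
    chi g != 1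
  & forall a (e : R), covered E (fun y => k (y - a) - k y) ->
      (forall y, `|k (y - a) - k y| <= e) -> sqn (chi a - 1) <= K * e ^+ 2].
Proof.
move=> tk Ek tu0 u0g.
have Qq : quadratic translate (form id) by apply: form_quadratic.
have Q0 v : 0 <= form id v by apply: form_ge0.
have corrT k' u : tame k' -> tame u -> tame (corr k' u) by exact: tame_corr.
have gq : quadratic translate (form (corr k)).
  by apply: form_quadratic => *;
    [exact: tame_corr|exact: corrD|exact: corrZ|exact: corr_shift].
have g0 v : 0 <= form (corr k) v by apply: form_ge0 => u; exact: tame_corr.
have formE L v : (forall u, tame u -> tame (L u)) -> form L v =
    dint (fun x => L (re_part v) x ^+ 2) + dint (fun x => L (im_part v) x ^+ 2).
  move=> LT; rewrite /form dintD//; apply: tame_sqr; apply: LT.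
    exact: tame_re.
  exact: tame_im.
have corr_form k' v : tame k' -> covered E k' -> form (corr k') v <=
    dint (fun x => k' x ^+ 2) * (size E)%:R * form id v.
  move=> tk' Ek'; rewrite !formE// => [|u]; last exact: tame_corr.
  by rewrite mulrDr lerD//; apply: dint_corr_le => //;
    [exact: tame_re|exact: tame_im].
pose c := dint (fun x => k x ^+ 2) * (size E)%:R + 1.
have c0 : 0 < c.
  by rewrite ltr_wpDl// mulr_ge0// dint_ge0// => [|x];
    [exact: tame_sqr|exact: sqr_ge0].
have gc v : form (corr k) v <= c * form id v.
  by rewrite mulrDl mul1r (le_trans (corr_form k v tk Ek))// lerDl.
have v0P : (fun x => (u0 x)%:C : R[i]^o) \in tame_complex.
  by apply/asboolP; split => //; exact: tame0.
pose v0 := TameFun v0P.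
have gv0 : 0 < form (corr k) (translate g v0 - v0).
  rewrite formE => [|u]; last exact: tame_corr.
  apply: ltr_wpDr.
    apply: dint_ge0 => [|x]; last exact: sqr_ge0.
    by apply: tame_sqr; apply: tame_corr => //; exact: tame_im.
  suff -> : re_part (translate g v0 - v0) = fun y => u0 (y + g) - u0 y by [].
  by apply/funext => y; exact: raddfB.
have [chi [K [chi1 chiM chig K0 chieta]]] :=
  separating_character translateD translateZ translateA Qq Q0 gq g0 c0 gc gv0.
exists chi, (K * ((size E)%:R * (size E)%:R)); first by rewrite !mulr_ge0// ltW.
split=> // a e Eka ka; pose k' y := k (y - a) - k y.
have tk' : tame k' by apply: tameB => //; exact: tame_kernel.
rewrite -mulrA; apply: chieta => v.
have -> : form (corr k) (translate a v - v) = form (corr k') v.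
  rewrite !formE; do ?by move=> u; exact: tame_corr.
  have E1 u u' : tame u -> u' = (fun y => u (y + a) - u y) ->
    corr k u' = corr k' u.
    move=> tu ->; apply/funext => x; have tua := tame_shift a tu.
    have -> : (fun y => u (y + a) - u y) = (fun y => u (y + a) + -1 * u y).
      by apply/funext => y; rewrite mulN1r.
    rewrite corrD//; last exact: tameZ.
    rewrite corrZ// corr_shift// mulN1r /corr -dintB; last 2 first.
    - by apply: tameMl => //; have [] := tame_kernel (x + a) tk.
    - by apply: tameMl => //; have [] := tame_kernel x tk.
    congr dint; apply/funext => y; rewrite -mulrBl /k'.
    by rewrite opprD addrA.
  have -> : re_part (translate a v - v) =
    fun y => re_part v (y + a) - re_part v y.
    by apply/funext => y; exact: raddfB.
  have -> : im_part (translate a v - v) =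
    fun y => im_part v (y + a) - im_part v y.
    by apply/funext => y; exact: raddfB.
  by rewrite (E1 _ _ (tame_re v) erefl) (E1 _ _ (tame_im v) erefl).
apply: le_trans (corr_form k' v tk' Eka) _.
apply: ler_wpM2r => //; rewrite [leRHS]mulrAC; apply: ler_wpM2r => //.
rewrite mulrC; apply: le_trans (ler_norm _) _.
apply: dint_norm => [y|y]; first by rewrite sqrf_eq0; exact: Eka.
by rewrite normrX lerXn2r ?nnegrE// (le_trans _ (ka y)).
Qed.

End DeloneIntegral.

(** * Continuous characters separate points *)

Section SeparatingCharacters.
Context {R : realType} {G : topologicalZmodType}.
Implicit Types (x y t a g : G) (N U V W K : set G).

Let nbhs_translate N x : nbhs 0 N -> nbhs x [set y | N (y - x)].
Proof.
move=> N0; have := @add_continuous G (x, - x) N; rewrite /= subrr => /(_ N0).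
move=> [[A B] /= [Ax Bx] AB]; apply: filterS Ax => y Ay.
by apply: (AB (y, - x)); split=> //; exact: nbhs_singleton Bx.
Qed.

Let nbhs0_halve N : nbhs 0 N ->
  exists U, [/\ nbhs 0 U, forall x, U x -> U (- x), U 0 &
    forall x y, U x -> U y -> N (x + y)].
Proof.
move=> N0; have := @add_continuous G (0, 0) N; rewrite /= addr0 => /(_ N0).
move=> [[A B] /= [A0 B0] AB].
pose C := A `&` B; have C0 : nbhs 0 C by exact: filterI.
have CN0 : nbhs 0 [set x | C (- x)].
  by have := @opp_continuous G 0 C; rewrite oppr0; apply.
exists (C `&` [set x | C (- x)]); split.
- exact: filterI.
- by move=> x [Cx CNx]; split=> //=; rewrite opprK.
- by split; rewrite /= ?oppr0; exact: nbhs_singleton C0.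
- by move=> x y [[Ax _] _] [[_ By] _]; exact: (AB (x, y)).
Qed.

Let compact_translates K W : compact K -> nbhs 0 W ->
  exists E : seq G, forall x, K x -> exists2 e, e \in E & W (x - e).
Proof.
move=> + W0; move/compact_near_coveringP => cK.
pose above (l : seq G) := [set l' : seq G | {subset l <= l'}].
have FF : ProperFilter (filter_from [set: seq G] above).
  apply: filter_from_proper; last by move=> l _; exists l => x.
  apply: filter_from_filter; first by exists [::].
  move=> l1 l2 _ _; exists (l1 ++ l2) => // l ll.
  by split=> x xl; apply: ll; rewrite mem_cat xl ?orbT.
have : \forall l \near filter_from [set: seq G] above,
    K `<=` [set x | exists2 e, e \in l & W (x - e)].
  apply: (cK (seq G) _ (fun l x => exists2 e, e \in l & W (x - e))) => x Kx.
  exists ([set y | W (y - x)], above [:: x]) => /=.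
    split; first exact: nbhs_translate.
    by exists [:: x].
  by move=> [y l] /= [Wy xl]; exists x => //; apply: xl; exact: mem_head.
by move=> nl; have [E EP] := @filter_ex _ _ FF _ nl; exists E.
Qed.

(** A maximal family of points with differences outside [V] meets every
    translate of [V]. *)
Let separated_set V : V 0 -> (forall x, V x -> V (- x)) ->
  exists X : set G, (forall x y, X x -> X y -> V (x - y) -> x = y) /\
    forall t, exists2 x, X x & V (x + t).
Proof.
move=> V0 VN; pose sep (X : set G) := forall x y, X x -> X y -> V (x - y) ->
  x = y.
have [F FP Ftot|X [Xsep Xmax]] := @Zorn_bigcup G sep.
  move=> x y [A FA Ax] [B FB By]; have [AB|BA] := Ftot _ _ FA FB.
    by apply: (FP _ FB) => //; exact: AB.
  by apply: (FP _ FA) => //; exact: BA.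
exists X; split=> // t; apply: contrapT => nX.
have nXt x : X x -> ~ V (x + t) by move=> Xx Vx; apply: nX; exists x.
apply: (Xmax (X `|` [set - t])).
  split; first exact: subsetUl.
  by move=> /(_ (- t) (or_intror erefl)) /nXt; rewrite addNr.
move=> x y [Xx|->] [Xy|->] //; first exact: Xsep.
  by rewrite opprK => /(nXt _ Xx).
by rewrite -opprD => /VN; rewrite opprK addrC => /(nXt _ Xy).
Qed.

(** A continuous function with compact support is uniformly continuous. The
    supremum over the whole group reduces to the compact set because both
    [y] and [y - a] may play the role of the point of [K]. *)
Let uniformly_continuous (k : G -> R) U K (e : R) : continuous k ->
  compact K -> nbhs 0 U -> U `<=` K -> (forall y, k y != 0 -> U y) -> 0 < e ->
  \forall a \near (0 : G), forall y, `|k (y - a) - k y| <= e.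
Proof.
move=> kc cK U0 UK kU e0.
have near_k (s : G -> G) : continuous s -> s 0 = 0 ->
    \forall a \near (0 : G), forall y, K y -> `|k (y + s a) - k y| <= e.
  move=> sc s0; move/compact_near_coveringP: cK => cK.
  apply: (cK G (nbhs (0 : G)) (fun a y => `|k (y + s a) - k y| <= e)) => y Ky.
  have kcont : {for (y, 0 : G),
    continuous (fun p : G * G => k (p.1 + s p.2) - k p.1)}.
    apply: (@continuousB R R^o).
      apply: (@continuous_comp _ _ _ (fun p : G * G => p.1 + s p.2) k);
        last exact: kc.
      apply: (@continuous_comp _ _ _ (fun p : G * G => (p.1, s p.2))
        (fun p => p.1 + p.2)).
        apply: cvg_pair => /=; first exact: cvg_fst.
        by apply: cvg_comp; [exact: cvg_snd|exact: sc].
      exact: add_continuous.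
    by apply: cvg_comp; [exact: cvg_fst|exact: kc].
  have := kcont [set r : R | `|r| <= e]; rewrite /= s0 addr0 subrr.
  apply; exists e => //= r /=; rewrite sub0r normrN; exact: ltW.
near=> a => y.
have [Ky|nKy] := pselect (K y).
  by move: y Ky; near: a; apply: (near_k -%R) => //;
    [exact: opp_continuous|exact: oppr0].
have k0 : k y = 0 by apply/eqP; apply: contrapT => /negP /kU /UK.
have [Ky|nKy'] := pselect (K (y - a)).
  rewrite distrC -[in X in `|X - _|](subrK a y).
  by move: (y - a) Ky; near: a; apply: (near_k id) => // ? ?.
have -> : k (y - a) = 0 by apply/eqP; apply: contrapT => /negP /kU /UK.
by rewrite k0 subrr normr0 ltW.
Unshelve. all: by end_near. Qed.

(** The kernel [k] is a bump at the neutral element, so narrow that correlating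
    with it does not mix the indicator function of [V] with its translate by
    [g]; therefore the correlation distinguishes them, as required by
    [character_of_kernel]. The uniform continuity of [k] becomes the continuity
    of the character. *)
Lemma characters_separate g : locally_compact [set: G] -> hausdorff_space G ->
  g != 0 -> exists2 chi : G -> Cplx R, character chi & chi g != 1.
Proof.
move=> lcG hG g0.
have [K] := lcG 0 I; rewrite withinET => K0 [cK clK].
have N0 : nbhs 0 (K `&` ~` [set - g]).
  apply: filterI => //; apply: open_nbhs_nbhs; split.
    by apply: closed_openC; apply: accessible_closed_set1;
      exact: hausdorff_accessible.
  by move=> /= /esym/eqP; rewrite oppr_eq0; exact/negP.
have [U2 [U20 U2N U20' U2D]] := nbhs0_halve N0.
have [U [U0 UN U0' UD]] := nbhs0_halve U20.
have UK x y : U x -> U y -> K (x + y).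
  by move=> /UD/[apply] Uxy; have [] := U2D _ _ Uxy U20'; rewrite addr0.
have UK1 : U `<=` K by move=> x Ux; have := UK _ _ Ux U0'; rewrite addr0.
have [k [kc k_ge0 k_le1 k0 kU]] : exists k : G -> R,
    [/\ continuous k, forall x, 0 <= k x, forall x, k x <= 1, k 0 = 1 &
      forall x, k x != 0 -> U x].
  have nU : ~ (~` U°) 0 by rewrite /= notK.
  have cU : closed (~` U°) by apply: open_closedC; exact: open_interior.
  have /(_ R)[f [fc f01 f0 f1]] :=
    (uniform_separatorP _ _).1 (@locally_compact_completely_regular G R lcG hG
      0 _ cU nU).
  have f_itv x : 0 <= f x <= 1 by have := f01 (f x) (imageT f x);
    rewrite /= in_itv.
  exists (fun x => 1 - f x); split.
  - by move=> x; apply: cvgB; [exact: cvg_cst|exact: fc].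
  - by move=> x; rewrite subr_ge0; case/andP: (f_itv x).
  - by move=> x; rewrite gerBl; case/andP: (f_itv x).
  - by rewrite (f0 (f 0)) ?subr0//; exists 0.
  - move=> x; apply: contra_neqP => nUx; apply/eqP; rewrite subr_eq0 eq_sym;
    apply/eqP.
    by apply: f1; exists x => // /interior_subset.
(* [k] exceeds 1/2 on differences of elements of [V] *)
have V1 : nbhs 0 (U `&` [set x | 1 / 2 < k x]).
  apply: filterI => //.
  by apply: (cvgr_gt _ (kc 0)); rewrite k0 ltr_pdivrMr// mul1r ltr1n.
have [V [V0 VN V0' VD]] := nbhs0_halve V1.
have VU x : V x -> U x by move=> Vx; have [] := VD _ _ Vx V0'; rewrite addr0.
have [W [W0 WN W0' WD]] := nbhs0_halve V0.
have WV x : W x -> V x by move=> Wx; have := WD _ _ Wx W0'; rewrite addr0.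
have [E EP] := compact_translates cK W0.
have [X [Xsep Xcov]] := separated_set V0' VN.
have [m mP] := @invariant_mean_exists R G.
have WH x y : W x -> W y -> exists2 h, h \in E & W (x + y - h).
  by move=> Wx Wy; apply: EP; apply: UK; apply/VU/WV.
have XW x y t : X x -> X y -> W (x - t) -> W (y - t) -> x = y.
  move=> Xx Xy Wx /WN Wy; apply: Xsep => //.
  by have := WD _ _ Wx Wy; rewrite opprB addrA subrK.
have covK (f : G -> R) : (forall y, f y != 0 -> K y) -> covered W E f.
  by move=> fK y /fK /EP.
have tk : tame W k.
  split; first by exists 1 => x; rewrite ger0_norm.
  by exists E; apply: covK => y /kU /UK1.
pose u0 y : R := (`[< V y >])%:R.
have u0P y : u0 y != 0 -> V y by rewrite pnatr_eq0 eqb0 negbK => /asboolP.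
have u0V y : V y -> u0 y = 1 by move=> Vy; rewrite /u0 asboolT.
have u0_ge0 y : 0 <= u0 y by rewrite ler0n.
have tu0 : tame W u0.
  split; first by exists 1 => x; rewrite normr_nat lern1 leq_b1.
  by exists E; apply: covK => y /u0P /VU /UK1.
have tu0g := tame_shift g tu0.
have [bk _] := tk.
have corr_u0 z : V z -> 1 / 2 <= corr m X k u0 z.
  move=> Vz; apply: (dint_ge mP XW) => [|y|s].
  - by apply: tameMl => //; have [M kM] := bk; exists M.
  - by rewrite mulr_ge0.
  have [x Xx Vx] := Xcov s; exists x => //; rewrite (u0V _ Vx) mulr1 ltW//.
  by have [] := VD _ _ Vx (VN _ Vz).
have corr_u0g z : V z -> corr m X k (fun y => u0 (y + g)) z = 0.
  move=> Vz; rewrite /corr.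
  rewrite (_ : (fun _ => _) = fun y => 0 * u0 y).
    by rewrite (dintZ mP XW) ?mul0r.
  apply/funext => y; rewrite mul0r; apply/eqP; rewrite mulf_eq0.
  apply: contrapT => /negP; rewrite negb_or => /andP[/kU Uyz /u0P Vyg].
  (* [- g] is the sum of three elements of [U] *)
  have /UD /(_ (VU _ Vz)) := Uyz.
  rewrite subrK => U2y; have := UD _ _ (UN _ (VU _ Vyg)) U0'.
  rewrite addr0 => U2yg; have [_] := U2D _ _ U2y U2yg; apply.
  by rewrite opprD addrA subrr add0r.
have corr_pos : 0 < dint m X (fun x => corr m X k (fun y =>
  u0 (y + g) - u0 y) x ^+ 2).
  apply: (@lt_le_trans _ _ (1 / 4)); first by rewrite divr_gt0.
  apply: (dint_ge mP XW) => [|y|s].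
  - apply: tame_sqr; apply: (tame_corr mP WN WH XW) => //; exact: tameB.
  - exact: sqr_ge0.
  have [x Xx Vx] := Xcov s; exists x => //.
  have -> : (fun y => u0 (y + g) - u0 y) = (fun y => u0 (y + g) + -1 * u0 y).
    by apply/funext => y; rewrite mulN1r.
  rewrite (corrD mP XW)//; last exact: tameZ.
  rewrite (corrZ mP XW)// corr_u0g// add0r mulN1r sqrrN.
  rewrite (_ : 1 / 4 = (1 / 2) ^+ 2); last by field.
  apply: lerXn2r (corr_u0 _ Vx); rewrite nnegrE ?divr_ge0//.
  by apply: le_trans (corr_u0 _ Vx); rewrite divr_ge0.
have Ek : covered W E k by apply: covK => y /kU /UK1.
have [chi [L L0 [chi1 chiM chig chiL]]] :=
  character_of_kernel mP WN WH XW tk Ek tu0 corr_pos.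
exists chi => //; split=> // [x|x]; last exact: sqn1_norm.
apply/cvgrPdist_le => e e0.
have eE : e = (complex.Re e)%:C by rewrite RRe_real// gtr0_real.
set r := complex.Re e in eE; have r0 : 0 < r by rewrite -ltcR -eE.
have rL0 : 0 < r / (L + 1) by rewrite divr_gt0// ltr_wpDl.
have near1 : \forall a \near (0 : G), sqn (chi a - 1) <= r ^+ 2.
  near=> a.
  have Ua : U a by near: a.
  apply: (@le_trans _ _ (L * (r / (L + 1)) ^+ 2)).
    apply: chiL => [|y].
      apply: covK => y kN; have [ky|/kU/UK1//] := eqVneq (k y) 0.
      move: kN; rewrite ky subr0 => /kU Uya.
      by rewrite -(subrK a y); exact: UK.
    by move: y; near: a; exact: (uniformly_continuous kc cK U0 UK1 kU rL0).
  rewrite expr_div_n mulrCA ler_piMr ?sqr_ge0//.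
  rewrite ler_pdivrMr ?exprn_gt0 ?ltr_wpDl// mul1r expr2.
  by rewrite -[leLHS]mulr1 ler_pM// ?lerDl// ?lerDr.
near=> y.
have chiyx : chi y = chi (y - x) * chi x by rewrite -chiM subrK.
rewrite distrC chiyx -[X in _ - X]mul1r -mulrBl normrM (sqn1_norm (chi1 x))
  mulr1.
rewrite -(@ler_pXn2r _ 2)// ?nnegrE ?(ltW e0)// sqn_norm eE -rmorphXn lecR.
near: y; exact: (nbhs_translate x near1).
Unshelve. all: by end_near. Qed.

End SeparatingCharacters.

(** * Averages of characters *)

Section CharacterAverages.
Context {R : realType} {G : topologicalZmodType}.
Implicit Types (g h : G) (chi : G -> Cplx R) (l : seq (G -> Cplx R)).

Lemma character0 chi : character chi -> chi 0 = 1.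
Proof.
move=> [_ chiM chi1]; have chi0 : chi 0 != 0 by rewrite -normr_gt0 chi1.
by apply: (mulfI chi0); rewrite -chiM addr0 mulr1.
Qed.

Lemma characterN chi g : character chi -> chi (- g) = (chi g)^*.
Proof.
move=> chic; have [_ chiM chi1] := chic.
have chig0 : chi g != 0 by rewrite -normr_gt0 chi1.
apply: (mulfI chig0); rewrite -chiM subrr character0// -normCK chi1.
by rewrite expr1n.
Qed.

Lemma character_cst1 : character (fun _ : G => 1 : Cplx R).
Proof.
by split=> [x|g h|g]; [exact: cvg_cst|rewrite mulr1|rewrite normr1].
Qed.

Lemma characterM chi1 chi2 : character chi1 -> character chi2 ->
  character (fun g => chi1 g * chi2 g).
Proof.
move=> [c1 m1 n1] [c2 m2 n2]; split=> [x|g h|g].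
- by apply: cvgM; [exact: c1|exact: c2].
- by rewrite m1 m2 mulrACA.
- by rewrite normrM n1 n2 mulr1.
Qed.

Lemma characterX chi n : character chi -> character (fun g => chi g ^+ n).
Proof.
move=> chic; elim: n => [|n IH].
  by under eq_fun do rewrite expr0; exact: character_cst1.
by under eq_fun do rewrite exprS; exact: characterM.
Qed.

Definition char_avg l g : Cplx R := (\sum_(chi <- l) chi g) / (size l)%:R.

Lemma char_avg_norm l g : {in l, forall chi, character chi} ->
  `|char_avg l g| <= 1.
Proof.
move=> lc; rewrite normrM normfV normr_nat.
have [l0|l0] := eqVneq (size l) 0%N; first by rewrite l0 invr0 mulr0.
rewrite ler_pdivrMr ?ltr0n ?lt0n// mul1r (le_trans (ler_norm_sum _ _ _))//.
rewrite big_seq (eq_bigr (fun=> 1)) => [|chi /lc[_ _ ->]//].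
by rewrite -big_seq big_const_seq count_predT iter_addr_0.
Qed.

Lemma char_avg_mul l1 l2 g :
  char_avg [seq (fun x => c1 x * c2 x) | c1 <- l1, c2 <- l2] g =
  char_avg l1 g * char_avg l2 g.
Proof.
rewrite /char_avg size_allpairs big_allpairs_dep natrM invfM [RHS]mulrACA.
by congr (_ * _); rewrite mulr_suml; apply: eq_bigr => c1 _; rewrite mulr_sumr.
Qed.

Lemma char_avg_powers chi g n : character chi -> chi g != 1 ->
  `|char_avg [seq (fun x => chi x ^+ k) | k <- iota 0 n.+1] g| <=
  2 / `|1 - chi g| / n.+1%:R.
Proof.
move=> [_ _ chi1] chig; rewrite /char_avg size_map size_iota big_map.
rewrite normrM normfV normr_nat ler_wpM2r ?invr_ge0//.
have n0 : 0 < `|1 - chi g| by rewrite normr_gt0 subr_eq0 eq_sym.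
rewrite ler_pdivlMr// -normrM mulrC.
rewrite -[iota _ _]/(index_iota 0 n.+1) big_mkord -opprB mulNr -subrX1 opprB.
by rewrite (le_trans (ler_normB _ _))// normr1 normrX chi1 expr1n.
Qed.

(** If the characters separate points, averaging over enough products of
    characters is close to the projection onto the neutral element. *)
Lemma small_char_avg (S : seq G) (e : R) :
  (forall g, g != 0 -> exists2 chi : G -> Cplx R, character chi & chi g != 1) ->
  0 < e ->
  exists l, [/\ (0 < size l)%N, {in l, forall chi, character chi} &
    forall h, h \in S -> h != 0 -> `|char_avg l h| <= e%:C].
Proof.
move=> sep e0; elim: S => [|g S [l [l0 lc lS]]].
  exists [:: fun=> 1]; split=> // chi; rewrite inE => /eqP ->.
  exact: character_cst1.
have [g0|g0] := eqVneq g 0.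
  exists l; split=> // h; rewrite inE => /predU1P[->|hS]; last exact: lS.
  by rewrite g0 eqxx.
have [chi chic chig] := sep g g0.
have r0 : 0 < `|1 - chi g| by rewrite normr_gt0 subr_eq0 eq_sym.
have [n nP] : exists n : nat, 2 / `|1 - chi g| <= n.+1%:R * e%:C.
  have rE : `|1 - chi g| = (complex.Re `|1 - chi g|)%:C.
    by rewrite RRe_real// normr_real.
  move: r0; rewrite rE; set r := complex.Re _ => r0.
  have {}r0 : 0 < r by rewrite -ltcR.
  exists (Num.trunc (2 / r / e)).
  have := ltW (truncnS_gt (2 / r / e)); rewrite ler_pdivrMr// -lecR.
  by rewrite !rmorphM fmorphV !rmorph_nat.
pose pw := [seq (fun x => chi x ^+ k) | k <- iota 0 n.+1].
have pwc : {in pw, forall c, character c}.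
  by move=> c /mapP[k _ ->]; exact: characterX.
exists [seq (fun x => c1 x * c2 x) | c1 <- pw, c2 <- l]; split.
- by rewrite size_allpairs size_map size_iota muln_gt0.
- by move=> c /allpairsP[[c1 c2] /= [c1P c2P ->]]; apply: characterM;
  [exact: pwc|exact: lc].
move=> h; rewrite inE char_avg_mul normrM => /predU1P[-> _|hS h0].
  rewrite -[leRHS]mulr1; apply: ler_pM => //; last exact: char_avg_norm.
  apply: le_trans (char_avg_powers _ chic chig) _.
  by rewrite ler_pdivrMr ?ltr0n// [leRHS]mulrC.
rewrite -[leRHS]mul1r; apply: ler_pM => //; first exact: char_avg_norm.
exact: lS.
Qed.

End CharacterAverages.

(** * Bounded operators *)

Section OperatorNormR.
Context {R : realType} {D : normedModType (Cplx R)}.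
Implicit Types (S T : bop D) (z : R[i]).

Definition opn T : R := opnorm T.

Lemma opnE T : `|T| = (opn T)%:C. Proof. by []. Qed.

Lemma opn_ge0 T : 0 <= opn T.
Proof. by apply: opnorm_ge0; exact: bopP. Qed.

Lemma opnD S T : opn (S + T) <= opn S + opn T.
Proof. by rewrite -lecR rmorphD -!opnE ler_normD. Qed.

Lemma opnN T : opn (- T) = opn T.
Proof. by apply: complexI; rewrite -!opnE normrN. Qed.

Lemma opn_dist S T : opn (S - T) = opn (T - S).
Proof. by rewrite -opnN opprB. Qed.

Lemma opn0 : opn (0 : bop D) = 0.
Proof. by apply: complexI; rewrite -opnE normr0. Qed.

Lemma opn_eq0 T : opn T <= 0 -> T = 0.
Proof.
move=> T0; apply/eqP; rewrite -normr_eq0 opnE; apply/eqP; congr (_%:C).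
by apply/eqP; rewrite eq_le T0 opn_ge0.
Qed.

Lemma opnZ (z : Cplx R) (r : R) T : `|z| <= r%:C -> opn (z *: T) <= r * opn T.
Proof.
move=> zr; rewrite -lecR rmorphM -!opnE normrZ ler_wpM2r//.
Qed.

Lemma opn_sum (I : eqType) (s : seq I) (F : I -> bop D) :
  opn (\sum_(i <- s) F i) <= \sum_(i <- s) opn (F i).
Proof.
elim: s => [|i s IH]; first by rewrite !big_nil opn0.
by rewrite !big_cons (le_trans (opnD _ _))// lerD2l.
Qed.

Lemma opnM S T : opn (S * T) <= opn S * opn T.
Proof.
apply: opnorm_le => [|x]; first by rewrite mulr_ge0 ?opn_ge0.
rewrite rmorphM -mulrA; apply: le_trans (opnormP _ (bopP S)) _.
by rewrite ler_wpM2l ?ler0c ?opn_ge0//; exact: opnormP (bopP T).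
Qed.

Lemma opn_isometry T : (forall x, `|T x| = `|x|) -> opn T <= 1.
Proof. by move=> Ti; apply: opnorm_le => // x; rewrite Ti mul1r. Qed.

Lemma scaler_bopl (z : Cplx R) S T : (z *: S) * T = z *: (S * T).
Proof. exact: bopE. Qed.

End OperatorNormR.

(** * Positive definite multipliers of finite support *)

Section AutocorrelationMultipliers.
Context {R : realType} {G : zmodType}.
Implicit Types (P : seq G) (f : G -> R) (g : G).

(** For [f] supported in the set of entries of the duplicate-free sequence [P],
    this is the positive definite function [g |-> sum_p f p * f (p + g)]. *)
Definition autocorr P f g : R :=
  \sum_(p <- P) \sum_(q <- P) f p * f q * (p - q + g == 0)%:R.

Lemma autocorr_ge0 P f g : (forall p, 0 <= f p) -> 0 <= autocorr P f g.
Proof. by move=> f0; do 2!apply: sumr_ge0 => ? _; rewrite !mulr_ge0. Qed.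

Lemma autocorr_sum_le P f (F : seq G) : (forall p, 0 <= f p) -> uniq F ->
  \sum_(g <- F) autocorr P f g <= \sum_(p <- P) \sum_(q <- P) f p * f q.
Proof.
move=> f0 uF; rewrite exchange_big; apply: ler_sum => p _ /=.
rewrite exchange_big; apply: ler_sum => q _ /=.
rewrite -mulr_sumr ler_piMr ?mulr_ge0//.
rewrite (eq_bigr (fun g => (g == q - p)%:R)) => [|g _]; last first.
  by rewrite addrC addr_eq0 opprB.
have [qp|qp] := boolP (q - p \in F).
  rewrite (bigD1_seq (q - p))//= eqxx big1 ?addr0// => g /negbTE ->.
  by [].
rewrite big_seq big1// => g gF; case: eqVneq => // gE.
by rewrite -gE gF in qp.
Qed.

(** The geometric mean lies between its two arguments. *)
Lemma geometric_mean_dist (x y : R) : 0 <= x -> 0 <= y ->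
  `|x - Num.sqrt (x * y)| <= `|x - y|.
Proof.
move=> x0 y0; have sqrtE (z : R) : 0 <= z -> Num.sqrt (z * z) = z.
  by move=> z0; rewrite -expr2 sqrtr_sqr ger0_norm.
have [xy|/ltW yx] := leP x y.
  have sx : x <= Num.sqrt (x * y)
    by rewrite -{1}(sqrtE x x0) ler_wsqrtr ?ler_wpM2l.
  rewrite distrC [leRHS]distrC !ger0_norm ?subr_ge0// lerD2r.
  by rewrite -{2}(sqrtE y y0) ler_wsqrtr ?ler_wpM2r.
have sx : Num.sqrt (x * y) <= x
  by rewrite -{2}(sqrtE x x0) ler_wsqrtr ?ler_wpM2l.
rewrite !ger0_norm ?subr_ge0// lerD2l lerN2.
by rewrite -{1}(sqrtE y y0) ler_wsqrtr ?ler_wpM2r.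
Qed.

(** Amenability again: the square root of a nearly invariant finitely supported
    probability gives an autocorrelation close to 1 on a given finite set. *)
Lemma autocorr_near1 (S : seq G) (e : R) : 0 < e ->
  exists P f, [/\ forall p, 0 <= f p, autocorr P f 0 = 1 &
    forall g, g \in S -> `|1 - autocorr P f g| <= e].
Proof.
move=> e0; have [l l0 lS] := almost_invariant_seq [seq - g | g <- S] e0.
pose nu p : R := (count_mem p l)%:R / (size l)%:R.
have nu0 p : 0 <= nu p by rewrite divr_ge0.
have avgE (h : G -> R) : avg l h = \sum_(p <- undup l) nu p * h p.
  rewrite /avg -(big_undup_iterop_count _ l xpredT h) mulr_suml.
  by apply: eq_bigr => p _; rewrite /nu mulrAC mulr_natl.
have nu_out p : p \notin undup l -> nu p = 0.
  by rewrite mem_undup => /count_memPn pl; rewrite /nu pl mul0r.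
pose f p := Num.sqrt (nu p).
have f_out p : p \notin undup l -> f p = 0 by move=> /nu_out pl;
  rewrite /f pl sqrtr0.
have phiE g : autocorr (undup l) f g = \sum_(p <- undup l) f p * f (p + g).
  apply: eq_bigr => p _; rewrite (eq_bigr (fun q =>
    if q == p + g then f p * f q else 0)).
    have [pg|pg] := boolP (p + g \in undup l).
      rewrite (bigD1_seq (p + g)) ?undup_uniq//= eqxx big1 ?addr0//.
      by move=> q /negbTE ->.
    rewrite (f_out _ pg) mulr0 big_seq big1// => q qP.
    by case: eqVneq => // qE; rewrite -qE qP in pg.
  move=> q _; rewrite addrAC subr_eq0 eq_sym.
  by case: ifP => _; rewrite ?mulr1// mulr0.
have nu_sum : \sum_(p <- undup l) nu p = 1.
  by have := avg_cst (1 : R) l0; rewrite avgE; under eq_bigr do rewrite mulr1.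
exists (undup l), f; split.
- by move=> p; exact: sqrtr_ge0.
- rewrite phiE -[RHS]nu_sum; apply: eq_bigr => p _.
  by rewrite addr0 -expr2 sqr_sqrtr.
move=> g gS; rewrite phiE -nu_sum -sumrB.
apply: (@le_trans _ _ (\sum_(p <- undup l) `|nu p - nu (p + g)|)).
  apply: le_trans (ler_norm_sum _ _ _) _; apply: ler_sum => p _.
  by rewrite /f -sqrtrM// geometric_mean_dist.
pose h p : R := if p \in undup l then Num.sg (nu p - nu (p + g)) else 0.
have h1 p : `|h p| <= 1.
  by rewrite /h; case: ifP => _; rewrite ?normr0// normr_sg lern1 leq_b1.
have := lS (- g) (map_f _ gS) h h1.
have -> : avg l h - avg l (fun x => h (x - g)) =
    \sum_(p <- undup l) `|nu p - nu (p + g)|; last first.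
  by apply: le_trans; exact: ler_norm.
have -> : avg l (fun x => h (x - g)) = \sum_(p <- undup l) nu (p + g) * h p.
  pose F q := nu q * h (q - g).
  have -> : \sum_(p <- undup l) nu (p + g) * h p =
      \sum_(q <- [seq p + g | p <- undup l] | q \in undup l) F q.
    rewrite big_map [RHS]big_mkcond; apply: eq_bigr => p _; rewrite /F addrK.
    by case: ifPn => // /nu_out ->; rewrite mul0r.
  have -> : avg l (fun x => h (x - g)) =
    \sum_(q <- undup l | q - g \in undup l) F q.
    rewrite avgE [RHS]big_mkcond; apply: eq_bigr => q _; rewrite /F /h.
    by case: ifP => // _; rewrite mulr0.
  rewrite -[LHS]big_filter -[RHS]big_filter; apply/perm_big/uniq_perm.
  - by rewrite filter_uniq ?undup_uniq.
  - by rewrite filter_uniq// map_inj_uniq ?undup_uniq//; exact: addIr.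
  move=> q; rewrite !mem_filter andbC; congr (_ && _).
  by rewrite -[q in RHS](subrK g) (mem_map (@addIr _ g)).
rewrite avgE -sumrB big_seq [RHS]big_seq; apply: eq_bigr => p pl.
by rewrite -mulrBl /h pl mulrC -normrEsg.
Qed.

End AutocorrelationMultipliers.

(** * Completeness of the algebra of bounded operators *)

Section OperatorCompleteness.
Context {R : realType} {D : completeNormedModType (Cplx R)}.
Implicit Types (x y : D) (S : bop D).

Let inv_cvg (e : Cplx R) : 0 < e -> \forall n \near \oo,
  (n.+1%:R^-1 : R)%:C <= e.
Proof.
move=> e0; have eE : e = (complex.Re e)%:C by rewrite RRe_real// gtr0_real.
move: e0; rewrite eE; set r := complex.Re e => /[!ltcR] r0.
near=> n; rewrite lecR invf_ple ?posrE//.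
apply: le_trans (ltW (truncnS_gt _)) _; rewrite ler_nat ltnS.
by near: n; exists (Num.trunc r^-1).
Unshelve. all: by end_near. Qed.

(** Completeness of the algebra of bounded operators, in the form needed to
    extend the coefficient maps. *)
Lemma bop_cauchy_limit (F : nat -> bop D) :
  (forall n m, opn (F n - F m) <= n.+1%:R^-1 + m.+1%:R^-1) ->
  exists S, forall n, opn (F n - S) <= n.+1%:R^-1.
Proof.
move=> FC.
have Fdist n m x : `|F n x - F m x| <= (n.+1%:R^-1 + m.+1%:R^-1 : R)%:C * `|x|.
  apply: le_trans (opnormP x (bopP (F n - F m))) _.
  by rewrite ler_wpM2r// lecR FC.
have Fcv x : exists y, (fun n => F n x) @ \oo --> y.
  suff : cvg ((fun n => F n x) @ \oo) by move/cvg_ex.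
  apply: cauchy_cvg; apply: cauchy_exP => e e0.
  have d0 : 0 < e / (2 * (`|x| + 1)).
    by rewrite divr_gt0// mulr_gt0// ltr_wpDl.
  have [N _ NP] := inv_cvg d0.
  exists (F N x); exists N => // n /= Nn; rewrite -ball_normE /ball_ /=.
  apply: le_lt_trans (Fdist N n x) _; rewrite rmorphD mulrDl.
  have le_half m : (N <= m)%N -> (m.+1%:R^-1 : R)%:C * `|x| < e / 2.
    move=> /NP le; apply: (@le_lt_trans _ _ (e / (2 * (`|x| + 1)) * `|x|)).
      by rewrite ler_wpM2r.
    rewrite mulrAC ltr_pdivrMr ?mulr_gt0 ?ltr_wpDl// mulrA divfK ?pnatr_eq0//.
    by rewrite ltr_pM2l// ltrDl.
  by rewrite [ltRHS]splitr ltrD// le_half.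
have [s sP] := choice Fcv.
have s_dist n x : `|F n x - s x| <= (n.+1%:R^-1 : R)%:C * `|x|.
  apply/ler_addgt0Pr => e e0.
  have d0 : 0 < e / (2 * (`|x| + 1)).
    by rewrite divr_gt0// mulr_gt0// ltr_wpDl.
  have e20 : 0 < e / 2 by rewrite divr_gt0.
  have /cvgrPdist_le/(_ _ e20) near_s := sP x.
  have [m [sm dm]] := filter_ex (filterI near_s (inv_cvg d0)).
  rewrite -(subrKA (F m x)) (le_trans (ler_normD _ _))//.
  rewrite [e]splitr addrA; apply: lerD; last by rewrite distrC.
  apply: le_trans (Fdist n m x) _; rewrite rmorphD mulrDl lerD2l.
  apply: (@le_trans _ _ (e / (2 * (`|x| + 1)) * `|x|));
    first by rewrite ler_wpM2r.
  rewrite mulrAC ler_pdivrMr ?mulr_gt0 ?ltr_wpDl// mulrA divfK ?pnatr_eq0//.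
  by rewrite ler_pM2l// lerDl.
have s_lin : linear s.
  move=> a x y; apply: (cvg_unique _ (sP (a *: x + y))) => //.
  rewrite (_ : (fun n => _) = fun n => a *: F n x + F n y).
    apply: cvgD => //; apply: cvgZr => //; exact: sP.
  by apply/funext => n; have [-> _] := bopP (F n).
have s_bdd : bounded_operator s.
  split=> //; exists (opn (F 0%N) + 1) => x.
  rewrite -[s x](subrK (F 0%N x)) addrC (le_trans (ler_normD _ _))//.
  rewrite rmorphD mulrDl lerD//; first exact: opnormP (bopP _).
  by rewrite distrC (le_trans (s_dist 0%N x))// invr1.
exists (Bop (asboolT s_bdd)) => n; apply: opnorm_le => [|x].
  by rewrite invr_ge0.
exact: s_dist.
Qed.

End OperatorCompleteness.

(** * The coefficient maps of the algebra *)

Section Multipliers.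
Context {R : realType} {D : completeNormedModType (Cplx R)}.
Context {G : topologicalZmodType}.
Variables (A : set (bop D)) (T : G -> bop D).
Hypothesis Aalg : closed_subalgebra A.
Hypothesis Trep : isometric_representation T.
Hypothesis separation : forall g : G, g != 0 ->
  exists2 chi : G -> Cplx R, character chi & chi g != 1.
Hypothesis char_inv : forall (F : {fset G}) (a : G -> bop D) (chi : G ->
  Cplx R),
  (forall g, g \in F -> A (a g)) -> character chi ->
  `|\sum_(g <- F) a g * T g| = `|\sum_(g <- F) (chi g *: a g) * T g|.
Implicit Types (F : {fset G}) (a : G -> bop D) (g : G) (b : bop D).

Lemma opn_rep g : opn (T g) <= 1.
Proof. by apply: opn_isometry; case: Trep. Qed.

Lemma opn_mul_rep S g : opn (S * T g) <= opn S.
Proof.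
by rewrite (le_trans (opnM _ _))// ler_piMr ?opn_ge0// opn_rep.
Qed.

Definition multiply (phi : G -> R) a g : bop D := (phi g)%:C *: a g.

Let weighted F a (l : seq (G -> Cplx R)) (w : (G -> Cplx R) -> Cplx R) :
  coefs_in A F a -> {in l, forall chi, character chi} ->
  {in l, forall chi, 0 <= w chi} ->
  `|\sum_(g <- F) ((\sum_(chi <- l) w chi * chi g) *: a g) * T g| <=
  (\sum_(chi <- l) w chi) * `|finsum_op T F a|.
Proof.
move=> Fa lc w0.
have -> : \sum_(g <- F) ((\sum_(chi <- l) w chi * chi g) *: a g) * T g =
    \sum_(chi <- l) w chi *: \sum_(g <- F) (chi g *: a g) * T g.
  under [RHS]eq_bigr do rewrite scaler_sumr.
  rewrite exchange_big; apply: eq_bigr => g _ /=.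
  rewrite scaler_suml mulr_suml; apply: eq_bigr => chi _.
  by rewrite -scalerA scaler_bopl.
rewrite (le_trans (ler_norm_sum _ _ _))// mulr_suml big_seq [leRHS]big_seq.
apply: ler_sum => chi chil; rewrite normrZ -(char_inv Fa (lc _ chil)).
by rewrite ger0_norm ?w0.
Qed.

(** The multiplier is the average, over the characters [chi], of the twists by
    [chi] with the nonnegative weights [|sum_p f p * chi p| ^+ 2], and
    [autocorr P f 0] is the average of the weights. A suitable finite average
    does as well up to a small error, because only finitely many elements of
    the group matter for given [P] and [F]. *)
Lemma multiply_contraction F a (P : seq G) (f : G -> R) :
  coefs_in A F a -> (forall p, 0 <= f p) ->
  opn (finsum_op T F (multiply (autocorr P f) a)) <=
  autocorr P f 0 * opn (finsum_op T F a).
Proof.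
move=> Fa f0; set phi := autocorr P f.
pose C := \sum_(p <- P) \sum_(q <- P) f p * f q.
have C0 : 0 <= C by do 2!apply: sumr_ge0 => ? _; rewrite mulr_ge0.
pose M := \sum_(g <- F) opn (a g).
have M0 : 0 <= M by apply: sumr_ge0 => g _; exact: opn_ge0.
pose N := opn (finsum_op T F a); have N0 : 0 <= N by exact: opn_ge0.
apply/ler_addgt0Pr => e e0; rewrite -/N.
pose d := e / (C * (N + M) + 1).
have CNM0 : 0 <= C * (N + M) by rewrite mulr_ge0// addr_ge0.
have d0 : 0 < d by rewrite divr_gt0// ltr_wpDl.
pose S := [seq pq.1 - pq.2 + g | pq <- [seq (p, q) | p <- P, q <- P],
  g <- 0 :: enum_fset F].
have [l [l0 lc lS]] := small_char_avg S separation d0.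
pose w (chi : G -> Cplx R) : Cplx R :=
  (\sum_(p <- P) \sum_(q <- P) (f p * f q)%:C * chi (p - q)) / (size l)%:R.
have w0 : {in l, forall chi, 0 <= w chi}.
  move=> chi /lc chic; rewrite divr_ge0//.
  have -> : \sum_(p <- P) \sum_(q <- P) (f p * f q)%:C * chi (p - q) =
      `|\sum_(p <- P) (f p)%:C * chi p| ^+ 2.
    rewrite normCK rmorph_sum mulr_suml; apply: eq_bigr => p _.
    rewrite mulr_sumr; apply: eq_bigr => q _.
    have [_ chiM _] := chic.
    rewrite chiM (characterN q chic) rmorphM mulrACA; congr (_ * _).
    by rewrite rmorphM /= geC0_conj// ler0c.
  by rewrite exprn_ge0.
pose psi g := \sum_(chi <- l) w chi * chi g.
have psiE g : psi g = \sum_(p <- P) \sum_(q <- P) (f p * f q)%:C *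
  char_avg l (p - q + g).
  have -> : psi g = \sum_(chi <- l) \sum_(p <- P) \sum_(q <- P)
      (f p * f q)%:C * (chi (p - q + g) / (size l)%:R).
    rewrite /psi big_seq [RHS]big_seq; apply: eq_bigr => chi /lc [_ chiM _].
    rewrite /w mulrAC !mulr_suml; apply: eq_bigr => p _.
    rewrite !mulr_suml; apply: eq_bigr => q _.
    by rewrite [chi (p - q + g)]chiM !mulrA.
  rewrite exchange_big; apply: eq_bigr => p _.
  rewrite exchange_big; apply: eq_bigr => q _.
  by rewrite -mulr_sumr /char_avg mulr_suml.
have psi_phi g : g \in 0 :: enum_fset F -> `|psi g - (phi g)%:C| <= (d * C)%:C.
  move=> gF; rewrite psiE /phi /autocorr rmorph_sum -sumrB mulr_sumr rmorph_sum.
  apply: le_trans (ler_norm_sum _ _ _) _; rewrite big_seq [leRHS]big_seq.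
  apply: ler_sum => p pP; rewrite rmorph_sum -sumrB mulr_sumr rmorph_sum.
  apply: le_trans (ler_norm_sum _ _ _) _; rewrite big_seq [leRHS]big_seq.
  apply: ler_sum => q qP; rewrite [X in _ - X]rmorphM -mulrBr normrM.
  rewrite ger0_norm ?ler0c ?mulr_ge0// [d * _]mulrC [leRHS]rmorphM.
  rewrite ler_wpM2l ?ler0c ?mulr_ge0//.
  have [->|pqg] := eqVneq (p - q + g) 0.
    rewrite /char_avg (_ : \sum_(chi <- l) chi 0 = (size l)%:R).
      by rewrite divff ?pnatr_eq0 -?lt0n// rmorph1 subrr normr0 ler0c ltW.
    rewrite big_seq (eq_bigr (fun=> 1)) => [|chi /lc/character0//].
    by rewrite -big_seq big_const_seq count_predT iter_addr_0.
  rewrite rmorph0 subr0; apply: lS => //.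
  by apply/allpairsP; exists ((p, q), g); split=> //=; exact: allpairs_f.
have psi_sum : `|\sum_(chi <- l) w chi| <= (phi 0 + d * C)%:C.
  have -> : \sum_(chi <- l) w chi = psi 0.
    rewrite /psi big_seq [RHS]big_seq; apply: eq_bigr => chi /lc /character0 ->.
    by rewrite mulr1.
  rewrite -[psi 0](subrK (phi 0)%:C) (le_trans (ler_normD _ _))//.
  rewrite [phi 0 + _]addrC rmorphD lerD ?psi_phi ?mem_head//.
  by rewrite ger0_norm ?ler0c// autocorr_ge0.
have psi_op : opn (\sum_(g <- F) (psi g *: a g) * T g) <= (phi 0 + d * C) * N.
  rewrite -lecR -opnE rmorphM; apply: le_trans (weighted Fa lc w0) _.
  by rewrite ler_wpM2r// (le_trans (real_ler_norm _) psi_sum)// ger0_real//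
    big_seq sumr_ge0.
have diff : opn (finsum_op T F (multiply phi a) - \sum_(g <- F) (psi g *: a g)
  * T g)
    <= d * C * M.
  rewrite /finsum_op -sumrB (le_trans (opn_sum _ _))// mulr_sumr big_seq
    [leRHS]big_seq.
  apply: ler_sum => g gF; rewrite -mulrBl (le_trans (opn_mul_rep _ _))//.
  rewrite /multiply -scalerBl; apply: opnZ; rewrite distrC.
  by apply: psi_phi; rewrite inE gF orbT.
rewrite -[finsum_op _ _ _](subrK (\sum_(g <- F) (psi g *: a g) * T g)).
apply: le_trans (opnD _ _) _; apply: le_trans (lerD diff psi_op) _.
have : d * (C * (N + M)) <= e.
  rewrite /d mulrAC ler_pdivrMr ?ltr_wpDl// ler_wpM2l ?(ltW e0)//.
  by rewrite lerDl.
by rewrite mulrDl mulrDr; lra.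
Qed.

Let A0 : A 0. Proof. by case: Aalg. Qed.

Let AB x y : A x -> A y -> A (x - y).
Proof.
move=> Ax Ay; have [_ lin _ _] := Aalg.
by rewrite addrC -scaleN1r; exact: lin.
Qed.

Let coef_in F a g : coefs_in A F a -> A (coef F a g).
Proof. by move=> Fa; rewrite /coef; case: ifPn => // gF; exact: Fa. Qed.

(** With the autocorrelation of a point mass at 0, the multiplier keeps only
    the coefficient at 0. *)
Lemma star : property_star A T.
Proof.
move=> F a Fa; rewrite !opnE lecR.
pose f (_ : G) : R := 1.
have phiE g : autocorr [:: 0] f g = (g == 0)%:R.
  by rewrite /autocorr !big_seq1 !mul1r subrr add0r.
have f0 p : 0 <= f p by exact: ler01.
have := multiply_contraction [:: 0] Fa f0.
rewrite phiE eqxx mul1r; apply: le_trans.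
suff -> : coef F a 0 = finsum_op T F (multiply (autocorr [:: 0] f) a) by [].
rewrite /finsum_op /coef.
have mE g : multiply (autocorr [:: 0] f) a g * T g = if g == 0 then a g else 0.
  rewrite /multiply phiE; case: eqVneq => [->|_]; last by rewrite scale0r mul0r.
  by have [-> _ _] := Trep; rewrite scale1r mulr1.
rewrite (eq_bigr _ (fun g _ => mE g)).
have [F0|F0] := boolP (0 \in F); last first.
  rewrite big_seq big1// => g gF; case: eqVneq => // gE.
  by rewrite -gE gF in F0.
rewrite (bigD1_seq 0) ?fset_uniq//= eqxx big1 ?addr0// => g /negbTE ->.
by [].
Qed.

(** Multiplication by [T (- g)] on the right moves the coefficient at [g] to 0,
    without conjugating the coefficients. *)
Lemma opn_coef_le F a g : coefs_in A F a ->
  opn (coef F a g) <= opn (finsum_op T F a).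
Proof.
move=> Fa; pose F' := [fset h - g | h in F]%fset; pose a' h := a (h + g).
have Fa' : coefs_in A F' a'.
  by move=> _ /imfsetP[h hF ->]; rewrite /a' subrK; exact: Fa.
have -> : coef F a g = coef F' a' 0.
  rewrite /coef /a' add0r; congr (if _ then _ else _).
  apply/idP/imfsetP => [gF|[h hF /esym/eqP]].
    by exists g => //; rewrite subrr.
  by rewrite subr_eq0 => /eqP <-.
have := star Fa'; rewrite !opnE lecR => /le_trans; apply.
have [_ TD _] := Trep.
suff -> : finsum_op T F' a' = finsum_op T F a * T (- g) by exact: opn_mul_rep.
rewrite /finsum_op big_imfset /=; last by move=> x y _ _ /addIr.
rewrite mulr_suml; apply: eq_bigr => h _.
by rewrite /a' subrK TD mulrA.
Qed.

Let finsum_coef F F' a : (F `<=` F')%fset ->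
  finsum_op T F a = \sum_(g <- F') coef F a g * T g.
Proof.
move=> FF'; rewrite /finsum_op -(big_fset_incl _ FF'); last first.
  by move=> g _ gF; rewrite /coef (negbTE gF) mul0r.
by rewrite big_seq [RHS]big_seq; apply: eq_bigr => g gF; rewrite /coef gF.
Qed.

Definition subcoef F1 a1 F2 a2 g : bop D := coef F1 a1 g - coef F2 a2 g.

Lemma finsum_sub F1 a1 F2 a2 :
  finsum_op T (F1 `|` F2)%fset (subcoef F1 a1 F2 a2) =
  finsum_op T F1 a1 - finsum_op T F2 a2.
Proof.
rewrite (finsum_coef a1 (fsubsetUl F1 F2)) (finsum_coef a2 (fsubsetUr F1 F2)).
by rewrite -sumrB; apply: eq_bigr => g _; rewrite mulrBl.
Qed.

Let subcoef_in F1 a1 F2 a2 : coefs_in A F1 a1 -> coefs_in A F2 a2 ->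
  coefs_in A (F1 `|` F2)%fset (subcoef F1 a1 F2 a2).
Proof. by move=> Fa1 Fa2 g _; apply: AB; exact: coef_in. Qed.

Lemma coef_sub F1 a1 F2 a2 g :
  coef (F1 `|` F2)%fset (subcoef F1 a1 F2 a2) g = coef F1 a1 g - coef F2 a2 g.
Proof.
rewrite {1}/coef; case: ifPn => //; rewrite inE negb_or => /andP[g1 g2].
by rewrite /coef (negbTE g1) (negbTE g2) subrr.
Qed.

Lemma opn_coef_sub_le F1 a1 F2 a2 g : coefs_in A F1 a1 -> coefs_in A F2 a2 ->
  opn (coef F1 a1 g - coef F2 a2 g) <=
    opn (finsum_op T F1 a1 - finsum_op T F2 a2).
Proof.
by move=> Fa1 Fa2; rewrite -coef_sub -finsum_sub; apply: opn_coef_le;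
  exact: subcoef_in.
Qed.

Lemma generated_approx b (e : R) : generated_algebra A T b -> 0 < e ->
  exists F a, coefs_in A F a /\ opn (finsum_op T F a - b) <= e.
Proof.
move=> Bb e0; have e0' : 0 < (e%:C : Cplx R) by rewrite ltcR.
have [_ [[F [a [Fa ->]]] /=]] := Bb _ (nbhsx_ballx b _ e0').
rewrite -ball_normE /ball_ /= distrC opnE ltcR => /ltW le.
by exists F, a.
Qed.

Lemma generated_sum F a : coefs_in A F a ->
  generated_algebra A T (finsum_op T F a).
Proof. by move=> Fa; apply: subset_closure; exists F, a. Qed.

Lemma coefficient_exists g b : generated_algebra A T b ->
  exists y, forall F a, coefs_in A F a ->
    opn (coef F a g - y) <= opn (finsum_op T F a - b).
Proof.
move=> Bb.
have app n : exists p : {fset G} * (G -> bop D),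
    coefs_in A p.1 p.2 /\ opn (finsum_op T p.1 p.2 - b) <= n.+1%:R^-1.
  have [|F [a Fa]] := generated_approx Bb (e := n.+1%:R^-1).
    by rewrite invr_gt0.
  by exists (F, a).
have [s sP] := choice app.
have sC n := (sP n).1; have sd n := (sP n).2.
pose c n := coef (s n).1 (s n).2 g.
have [y yP] : exists y, forall n, opn (c n - y) <= n.+1%:R^-1.
  apply: bop_cauchy_limit => n m.
  apply: le_trans (opn_coef_sub_le g (sC n) (sC m)) _.
  rewrite -(subrKA b) (le_trans (opnD _ _))// lerD//.
  by rewrite opn_dist.
exists y => F a Fa; apply/ler_addgt0Pr => e e0.
pose n := Num.trunc (2 / e).
have ne : n.+1%:R^-1 + n.+1%:R^-1 <= e.
  rewrite -mulr2n -[leLHS]mulr_natl ler_pdivrMr// -ler_pdivrMl// mulrC ltW//.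
  exact: truncnS_gt.
rewrite -(subrKA (c n)) (le_trans (opnD _ _))//.
have t1 := opn_coef_sub_le g Fa (sC n); have t2 := yP n.
have t3 : opn (finsum_op T F a - finsum_op T (s n).1 (s n).2) <=
    opn (finsum_op T F a - b) + n.+1%:R^-1.
  by rewrite -(subrKA b) (le_trans (opnD _ _))// lerD2l opn_dist.
apply: le_trans (lerD t1 t2) _; apply: le_trans (lerD t3 (lexx _)) _.
by rewrite -addrA lerD2l.
Qed.

(** The extension by continuity of the coefficient at [g]: the inequality
    says that [y] is as close to the coefficient of a finite sum as [b] is to
    the sum, which determines [y] on the closure of the finite sums. *)
Definition coefficient g b : bop D :=
  xget 0 [set y | forall F a, coefs_in A F a ->
    opn (coef F a g - y) <= opn (finsum_op T F a - b)].

Lemma coefficientP g b F a : generated_algebra A T b -> coefs_in A F a ->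
  opn (coef F a g - coefficient g b) <= opn (finsum_op T F a - b).
Proof.
move=> /(coefficient_exists g)[y yP]; rewrite /coefficient.
case: xgetP => [z _ zP|/(_ y) nP]; first exact: zP.
by case: nP.
Qed.

Lemma coefficient_finsum g F a : coefs_in A F a ->
  coefficient g (finsum_op T F a) = coef F a g.
Proof.
move=> Fa; apply/esym/eqP; rewrite -subr_eq0; apply/eqP/opn_eq0.
apply: le_trans (coefficientP g (generated_sum Fa) Fa) _.
by rewrite subrr opn0.
Qed.

Lemma coefficient_lipschitz g b1 b2 :
  generated_algebra A T b1 -> generated_algebra A T b2 ->
  opn (coefficient g b1 - coefficient g b2) <= opn (b1 - b2).
Proof.
move=> B1 B2; apply/ler_addgt0Pr => e e0;
  have e20 : 0 < e / 2 by rewrite divr_gt0.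
have [F [a [Fa Fb]]] := generated_approx B1 e20.
rewrite -(subrKA (coef F a g)) (le_trans (opnD _ _))//.
have c1 := coefficientP g B1 Fa; have c2 := coefficientP g B2 Fa.
have : opn (finsum_op T F a - b2) <= e / 2 + opn (b1 - b2).
  by rewrite -(subrKA b1) (le_trans (opnD _ _))// lerD2r.
rewrite [opn (coefficient g b1 - _)]opn_dist.
move: c1 c2 Fb; do 5!move: (opn _) => ?; lra.
Qed.

Lemma coefficient_mem g b : generated_algebra A T b -> A (coefficient g b).
Proof.
move=> Bb; have [_ _ _ clA] := Aalg.
apply: clA => N /nbhs_ballP[e /= e0 eN].
have eE : e = (complex.Re e)%:C by rewrite RRe_real// gtr0_real.
move: e0 eN; rewrite eE; set r := complex.Re e => /[!ltcR] r0 eN.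
have r20 : 0 < r / 2 by rewrite divr_gt0.
have [F [a [Fa Fb]]] := generated_approx Bb r20.
exists (coef F a g); split; first exact: coef_in.
apply: eN; rewrite -ball_normE /ball_ /= distrC opnE ltcR.
apply: le_lt_trans (coefficientP g Bb Fa) _; apply: le_lt_trans Fb _.
by rewrite ltr_pdivrMr// mulr_natr mulr2n ltrDl.
Qed.

Lemma coefficient_mapP g : coefficient_map A T g (coefficient g).
Proof.
split=> [b|F a|]; [exact: coefficient_mem|exact: coefficient_finsum|].
apply/subspace_continuousP => b Bb; apply/cvgrPdist_le => e e0.
apply: (filterS _ (nbhsx_ballx b e e0)) => b'.
rewrite -ball_normE /ball_ /= => /ltW bb' Bb'; apply: le_trans bb'.
by rewrite !opnE lecR; exact: coefficient_lipschitz.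
Qed.

Let multiply_coef phi F a g : coef F (multiply phi a) g =
  (phi g)%:C *: coef F a g.
Proof. by rewrite /coef; case: ifP => // _; rewrite scaler0. Qed.

Let finsum_multiply_sub phi F1 a1 F2 a2 :
  finsum_op T (F1 `|` F2)%fset (multiply phi (subcoef F1 a1 F2 a2)) =
  finsum_op T F1 (multiply phi a1) - finsum_op T F2 (multiply phi a2).
Proof.
rewrite -finsum_sub; apply: eq_bigr => g _; congr (_ * _).
by rewrite /subcoef !multiply_coef -scalerBr.
Qed.

(** Multiplying by an autocorrelation of finite support close to 1 moves [b]
    little, and annihilates [b] in the limit when its coefficients vanish. *)
Lemma coefficients_separate b : generated_algebra A T b ->
  (forall g, coefficient g b = 0) -> b = 0.
Proof.
move=> Bb b0; apply: opn_eq0; apply/ler_addgt0Pr => e' e'0; rewrite add0r.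
(* [b] is at distance [e] from [b_0], then come errors [e], [e + e] and [e] *)
pose e := e' / 5; have e0 : 0 < e by rewrite divr_gt0.
have coef_le F a g : coefs_in A F a ->
  opn (coef F a g) <= opn (finsum_op T F a - b).
  by move=> Fa; have := coefficientP g Bb Fa; rewrite b0 subr0.
have [F0 [a0 [Fa0 Fb0]]] := generated_approx Bb e0.
pose M := \sum_(g <- F0) opn (a0 g).
have M0 : 0 <= M by apply: sumr_ge0 => g _; exact: opn_ge0.
have d0 : 0 < e / (M + 1) by rewrite divr_gt0// ltr_wpDl.
have [P [f [f0 phi0 phiS]]] := autocorr_near1 (enum_fset F0) d0.
set phi := autocorr P f in phi0 phiS.
pose K := \sum_(p <- P) \sum_(q <- P) f p * f q.
have K0 : 0 <= K by do 2!apply: sumr_ge0 => ? _; rewrite mulr_ge0.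
pose e1 := Num.min e (e / (K + 1)).
have e10 : 0 < e1 by rewrite lt_min e0 divr_gt0// ltr_wpDl.
have [F1 [a1 [Fa1 Fb1]]] := generated_approx Bb e10.
pose b_0 := finsum_op T F0 a0; pose b_1 := finsum_op T F1 a1.
pose m0 := finsum_op T F0 (multiply phi a0).
pose m1 := finsum_op T F1 (multiply phi a1).
have h1 : opn (b_0 - m0) <= e.
  rewrite /b_0 /m0 /finsum_op -sumrB (le_trans (opn_sum _ _))//.
  apply: (@le_trans _ _ (\sum_(g <- F0) e / (M + 1) * opn (a0 g))).
    rewrite big_seq [leRHS]big_seq; apply: ler_sum => g gF.
    rewrite -mulrBl (le_trans (opn_mul_rep _ _))//.
    have -> : a0 g - multiply phi a0 g = (1 - phi g)%:C *: a0 g.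
      by rewrite /multiply rmorphB rmorph1 scalerBl scale1r.
    by apply: opnZ; rewrite normc_def /= expr0n addr0 sqrtr_sqr lecR;
      exact: phiS.
  rewrite -mulr_sumr mulrAC ler_pdivrMr ?ltr_wpDl// ler_wpM2l ?(ltW e0)//.
  by rewrite lerDl.
have h2 : opn (m0 - m1) <= e + e.
  rewrite /m0 /m1 -finsum_multiply_sub.
  have := multiply_contraction P (subcoef_in Fa0 Fa1) f0.
  rewrite -/phi phi0 mul1r finsum_sub => /le_trans; apply.
  rewrite -(subrKA b) (le_trans (opnD _ _))// lerD//.
  by rewrite opn_dist (le_trans Fb1)// ge_min lexx.
have h3 : opn m1 <= e.
  rewrite /m1 /finsum_op (le_trans (opn_sum _ _))//.
  apply: (@le_trans _ _ (\sum_(g <- F1) phi g * e1)).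
    rewrite big_seq [leRHS]big_seq; apply: ler_sum => g gF.
    rewrite (le_trans (opn_mul_rep _ _))//.
    have phig : 0 <= phi g by exact: autocorr_ge0.
    apply: (@le_trans _ _ (phi g * opn (a1 g))).
      by apply: opnZ; rewrite ger0_norm ?ler0c.
    rewrite ler_wpM2l// (le_trans _ Fb1)//.
    by have := coef_le _ _ g Fa1; rewrite /coef gF.
  rewrite -mulr_suml.
  apply: (@le_trans _ _ (K * (e / (K + 1)))).
    apply: ler_pM; [|exact: ltW| |by rewrite ge_min lexx orbT].
      by apply: sumr_ge0 => g _; exact: autocorr_ge0.
    by apply: autocorr_sum_le => //; exact: fset_uniq.
  rewrite mulrCA ler_piMr ?(ltW e0)// ler_pdivrMr ?ltr_wpDl// mul1r.
  by rewrite lerDl.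
have -> : b = - (b_0 - b) + ((b_0 - m0) + ((m0 - m1) + m1)).
  by rewrite subrK subrK opprB subrK.
apply: le_trans (opnD _ _) _; rewrite opnN.
apply: le_trans (lerD (lexx _) (opnD _ _)) _.
apply: le_trans (lerD (lexx _) (lerD (lexx _) (opnD _ _))) _.
apply: le_trans (lerD Fb0 (lerD h1 (lerD h2 h3))) _.
by rewrite (_ : _ + _ = e')//; rewrite /e; field.
Qed.

Lemma double_star : property_double_star A T.
Proof.
split; first exact: star.
exists coefficient; split=> [|b Bb]; first exact: coefficient_mapP.
split=> [-> g|]; last exact: coefficients_separate.
have F0 : coefs_in A fset0 (fun _ : G => 0) by [].
by have := coefficient_finsum g F0; rewrite /finsum_op big_seq_fset0.
Qed.

End Multipliers.

Theorem theorem3p2 (R : realType) (G : topologicalZmodType)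
    (D : completeNormedModType (Cplx R)) (A : set (bop D)) (T : G -> bop D) :
  locally_compact [set: G] -> hausdorff_space G ->
  closed_subalgebra A ->
  isometric_representation T ->
  (forall g, [set T g * x * T (- g) | x in A] = A) ->
  (forall (F : {fset G}) (a : G -> bop D) (chi : G -> Cplx R),
      (forall g, g \in F -> A (a g)) -> character chi ->
      `|\sum_(g <- F) a g * T g| = `|\sum_(g <- F) (chi g *: a g) * T g|) ->
  property_star A T /\ property_double_star A T.
Proof.
move=> lcG hG Aalg Trep _ char_inv.
have sep g := @characters_separate R G g lcG hG.
split; first exact: (star Trep sep char_inv).
exact: (double_star Aalg Trep sep char_inv).
Qed.
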